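(* Let $W$ be one of the Coxeter groups $B_n$ with set of Coxeter generators $S$, let $p$ be a prime, and let $K\in E$, $L\in F$. If $p\neq 2$ then $d_{KL}=1$ if and only if $c_K$ and $c_L$ have conjugate $p$-regular parts (conjugate in $W$). If $p=2$ then $F=\{S\}$ and $d_{KS}=1$ for all $K\in E$.
   Context: For $J\subseteq S$, $W_J=\langle J\rangle$ and $c_J$ is a Coxeter element of $W_J$ (the product of the elements of $J$ in some order). $E$ is a set of representatives of the $W$-conjugacy classes of subsets of $S$. For $J,K\subseteq S$, $\beta_{JK}$ is the number of fixed points of $W_K$ on the coset space $W/W_J$; $M^c(W)=(\beta_{JK})_{J,K\in E}$ is the parabolic table of marks. For a prime $p$, $F\subseteq E$ is the set of $J\in E$ whose row of $M^c(W)$ is non-zero modulo $p$ (equivalently, $p\nmid [N_W(W_J):W_J]$). For $K\in E$, $L\in F$, $d_{KL}=1$ if columns $K$ and $L$ of $M^c(W)$ are equal modulo $p$, and $d_{KL}=0$ otherwise; $D=(d_{KL})$ is the decomposition matrix of the descent algebra $\Sigma_W$ modulo $p$. The $p$-regular part of $w\in W$ is the element $w'$ in the unique factorization $w=w'w''=w''w'$ with $w'$ of order prime to $p$ and $w''$ of $p$-power order. $B_n$ is realized as the group of all permutations of $\{\pm1,\dots,\pm n\}$ commuting with $i\mapsto -i$, with $S=\{s_0,\dots,s_{n-1}\}$, $s_0=(-1,1)$ and $s_i=(i,i+1)(-i,-i-1)$ for $1\le i\le n-1$. *)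

(* Defs.v *)
From mathcomp Require Import all_boot all_fingroup all_solvable.

Set Implicit Arguments.
Unset Strict Implicit.
Unset Printing Implicit Defensive.

Import GroupScope.

Section ParabolicMarks.

Variables (gT : finGroupType) (W : {group gT}) (S : {set gT}).
Implicit Types (J K L : {set gT}) (E : {set {set gT}}).

Definition subset_class_reps E : bool :=
  is_transversal E
    (equivalence_partition (fun J K => K \in J :^: W) (powerset S))
    (powerset S).

(* No order is fixed on J: every arrangement of its elements, each occurring
   exactly once, is allowed. *)
Definition coxeter_element J (x : gT) : Prop :=
  exists2 s : seq gT, perm_eq s (enum J) & x = \prod_(y <- s) y.

(* Group actions, and the composition of permutations, are on the right in
   MathComp, so the transitive W-set with point stabiliser W_J is the set of
   right cosets W_J w with W acting by right multiplication; w |-> w^-1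
   identifies it with the left cosets under left multiplication. *)
Definition mark J K : nat :=
  #|'Fix_(rcosets <<J>> W | 'Rs)(<<K>>)|.

Definition nonzero_rows (p : nat) E : {set {set gT}} :=
  [set J in E | [exists K in E, ~~ (p %| mark J K)%N]].

Definition decomp (p : nat) E K L : nat :=
  if [forall J in E, (mark J K == mark J L %[mod p])%N] then 1%N else 0%N.

End ParabolicMarks.

Section TypeB.

Variable n : nat.

(* (i, false) stands for the point i + 1, and (i, true) for -(i + 1). *)
Definition signed_pt : finType := ('I_n * bool)%type.

Definition opp_pt (x : signed_pt) : signed_pt := (x.1, ~~ x.2).

Lemma opp_pt_inj : injective opp_pt.
Proof. by case=> i a [j b] [-> /negb_inj->]. Qed.

Definition opp_perm : {perm signed_pt} := perm opp_pt_inj.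

Definition Bgroup : {group {perm signed_pt}} := 'C[opp_perm]%G.

(* Since the point k is (k - 1, false), for i > 0 the generator
   (i, i + 1)(-i, -i - 1) exchanges the indices i - 1 = ord_pred i and i;
   the cyclic wrap-around of ord_pred at 0 is never used. *)
Definition Bgen (i : 'I_n) : {perm signed_pt} :=
  if (i : nat) == 0 then tperm (i, false) (i, true)
  else tperm (ord_pred i, false) (i, false) * tperm (ord_pred i, true) (i, true).

Definition Bgens : {set {perm signed_pt}} := [set Bgen i | i : 'I_n].

End TypeB.

(* Main.v *)
(* [W_J] is the subgroup of [W] stabilising the sets {i + 1, ..., n} with
   [s_i] not in [J], and a set stabilised by [c_K] is stabilised by [K], since
   each [s_j] with [j <> i] preserves the size of the intersection with
   {i + 1, ..., n}, and so does its negative. Hence the mark [beta_JK] is the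
   number of fixed points of [c_K] on [W / W_J], and modulo [p] that of its
   [p]-regular part; this gives one implication.

   Conversely, for the maximal [J], the cosets of [W_J] are the sets of a given
   size containing no pair [x], [-x] (called isotropic below). If [u] has [a_m]
   pairs of opposite [m]-cycles, the [u]-stable isotropic sets are counted by
   the coefficients of the product of the (1 + 2 X^m)^(a_m). When [u] is
   [p]-regular, [a_m = 0] for [p | m], and the product modulo [p] then
   determines all the [a_m]. The remaining cycles are equal to their opposites;
   for [c_K] there is at most one, so its length is determined too, hence so are
   the lengths of the cycles into which it splits in the [p]-regular part. So
   the [p]-regular parts have the same signed cycle type.

   For [p = 2] and [J <> S], the central element [-1] is not in [W_J], so it acts
   without fixed points on the fixed cosets of [W_K], and all marks in row [J]
   are even. *)

Require Import Defs.
From mathcomp Require Import all_boot all_fingroup all_solvable.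
From mathcomp Require Import ssralg poly zmodp ring.

Set Implicit Arguments.
Unset Strict Implicit.
Unset Printing Implicit Defensive.

Import GroupScope GRing.Theory.

(** * Images of sets under permutations *)

Lemma imset_permM (T : finType) (a b : {perm T}) (A : {set T}) :
  (a * b) @: A = b @: (a @: A).
Proof. by rewrite -imset_comp; apply: eq_imset => x; rewrite /= permM. Qed.

Lemma imset_perm1 (T : finType) (A : {set T}) : (1 : {perm T}) @: A = A.
Proof. by rewrite -[RHS]imset_id; apply: eq_imset => x; rewrite perm1. Qed.

Lemma imset_perm_stable (T : finType) (a : {perm T}) (A : {set T}) :
  {in A, forall x, a x \in A} -> a @: A = A.
Proof.
move=> aA; apply/eqP; rewrite eqEcard card_imset ?leqnn ?andbT; last exact: perm_inj.
by apply/subsetP=> _ /imsetP[x xA ->]; apply: aA.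
Qed.

Lemma mem_imset_perm (T : finType) (a : {perm T}) (A : {set T}) x :
  a @: A = A -> (a x \in A) = (x \in A).
Proof. by move=> aA; rewrite -{1}aA mem_imset //; apply: perm_inj. Qed.

Lemma group_set_stab (T : finType) (A : {set T}) :
  group_set [set a : {perm T} | a @: A == A].
Proof.
apply/group_setP; split=> [|a b]; first by rewrite inE imset_perm1.
by rewrite !inE imset_permM => /eqP-> .
Qed.
Canonical stab_group (T : finType) (A : {set T}) := Group (group_set_stab A).

(** * Parabolic subgroups of type B *)

Section TypeB.

Variable n : nat.
Implicit Types (i j l : 'I_n) (e : bool) (x y : signed_pt n).
Implicit Types (w : {perm signed_pt n}) (J K : {set {perm signed_pt n}}).

Lemma BgroupP w :
  reflect (forall i e, w (i, ~~ e) = opp_pt (w (i, e))) (w \in Bgroup n).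
Proof.
apply: (iffP cent1P) => [wC i e|wC].
  by have /permP/(_ (i, e)) := wC; rewrite !permM !permE.
by apply/permP=> -[i e]; rewrite !permM !permE -wC.
Qed.

Lemma ord_pred_mod i : 0 < i -> (i + n).-1 %% n = i.-1.
Proof.
move=> i0; rewrite -(prednK i0) addSn /= modnDr modn_small //.
by rewrite (leq_ltn_trans (leq_pred _)).
Qed.

Lemma val_ord_pred i : 0 < i -> ord_pred i = i.-1 :> nat.
Proof. exact: ord_pred_mod. Qed.

Lemma ord_pred_neq i : i != 0 :> nat -> (ord_pred i == i) = false.
Proof.
move=> i0; apply/negP=> /eqP/(congr1 (@nat_of_ord n)).
rewrite val_ord_pred ?lt0n // => /eqP.
by rewrite -(inj_eq succn_inj) prednK ?lt0n // ltn_eqF.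
Qed.

Lemma BgenE i x :
  Bgen i x = if i == 0 :> nat then (if x.1 == i then (i, ~~ x.2) else x)
    else if x.1 == i then (ord_pred i, x.2)
    else if x.1 == ord_pred i then (i, x.2) else x.
Proof.
case: x => k e; rewrite /Bgen; have [i0|i0] := ifPn; rewrite ?permM !permE /= !xpair_eqE.
  by case: (altP (k =P i)) => [->|]; case: e.
have pi := ord_pred_neq i0.
case: (altP (k =P ord_pred i)) => [->|kp]; rewrite ?pi.
  by case: e; rewrite /= ?eqxx ?pi ?andbF //= !xpair_eqE ?eqxx ?pi ?andbF.
case: (altP (k =P i)) => [->|ki]; case: e; rewrite /= ?eqxx ?andbF ?andbT //=;
  rewrite ?xpair_eqE ?andbF ?(negPf kp) ?(negPf ki) //=.
all: by rewrite ?eqxx ?andbF ?pi //= (eq_sym i) pi.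
Qed.

Lemma Bgen_in i : Bgen i \in Bgroup n.
Proof.
apply/BgroupP=> k e; rewrite !BgenE /=.
by case: ifP => _; [case: ifP => _; rewrite /opp_pt | case: ifP => _; [|case: ifP]].
Qed.

Lemma Bgens_sub : Bgens n \subset Bgroup n.
Proof. by apply/subsetP=> _ /imsetP[i _ ->]; apply: Bgen_in. Qed.

Lemma Bgen_fix i x : i < x.1 -> Bgen i x = x.
Proof.
move=> ix; rewrite BgenE.
have xi : (x.1 == i) = false by rewrite -val_eqE gtn_eqF.
case: ifP => i0; rewrite xi //; case: eqP => // xp.
by move: ix; rewrite xp val_ord_pred ?lt0n ?i0 // ltnNge leq_pred.
Qed.

Lemma Bgen_neq i e : Bgen i (i, e) != (i, e).
Proof.
rewrite BgenE /= eqxx; case: ifPn => i0; rewrite xpair_eqE ?eqxx /=.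
  by case: e.
by rewrite andbT ord_pred_neq.
Qed.

Lemma Bgen_inj : injective (@Bgen n).
Proof.
move=> i j eq_ij; case: (ltngtP i j) => [lt_ij|lt_ji|/val_inj //].
  by have := Bgen_neq j true; rewrite -eq_ij Bgen_fix ?eqxx.
by have := Bgen_neq i true; rewrite eq_ij Bgen_fix ?eqxx.
Qed.

Lemma BgenK i : involutive (Bgen i).
Proof.
move=> [k e]; rewrite [Bgen i (k, e)]BgenE; case: ifPn => i0.
  rewrite /=; case: (altP (k =P i)) => [->|ki]; rewrite BgenE i0 /=.
    by rewrite eqxx negbK.
  by rewrite (negPf ki).
have pi := ord_pred_neq i0.
rewrite /fst /snd; case: (altP (k =P i)) => [->|ki].
  by rewrite BgenE (negPf i0) /fst /snd pi eqxx.
case: (altP (k =P _)) => [->|kp]; rewrite BgenE (negPf i0) /fst /snd ?eqxx //.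
by rewrite (negPf ki) (negPf kp).
Qed.

Lemma Bgen_moved i x : x.1 != i -> Bgen i x != x -> Bgen i x = (i, x.2).
Proof.
case: x => k e ki; rewrite BgenE /fst /snd in ki *; rewrite (negPf ki).
by case: ifP; [rewrite eqxx | case: ifP; rewrite ?eqxx].
Qed.

(** For [e = false] this is {l + 1, ..., n}, whose stabiliser in [Bgroup n] is the maximal parabolic
    subgroup omitting s_l; [e = true] gives the opposite set. *)
Definition tail l e : {set signed_pt n} := [set x : signed_pt n | (l <= x.1) && (x.2 == e)].

(** For i > 0, s_i exchanges the neighbouring indices i - 1 and i, which [l] separates only if i =
    l; s_0 changes the sign at index 0, which lies in a tail only if l = 0. *)
Lemma Bgen_tail i l e : i != l -> Bgen i @: tail l e = tail l e.
Proof.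
move=> il; apply: imset_perm_stable => -[x e']; rewrite !inE /= => /andP[lx /eqP->{e'}].
rewrite BgenE /=; case: ifPn => i0.
  case: eqP => [xi|_]; last by rewrite lx eqxx.
  by move: lx il; rewrite xi -val_eqE /= (eqP i0) leqn0 eq_sym => ->.
case: eqP => [xi|_] /=.
  rewrite eqxx andbT ord_pred_mod ?lt0n // -ltnS prednK ?lt0n //.
  by rewrite ltn_neqAle eq_sym val_eqE il -xi.
case: eqP => [xi|_] /=; last by rewrite lx eqxx.
rewrite eqxx andbT; apply: leq_trans lx _.
by rewrite xi val_ord_pred ?lt0n // leq_pred.
Qed.

Lemma gen_tail J w l e :
  J \subset Bgens n -> Bgen l \notin J -> w \in <<J>> -> w @: tail l e = tail l e.
Proof.
move=> JS lJ; suff sJ: <<J>> \subset stab_group (tail l e).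
  by move/(subsetP sJ); rewrite inE => /eqP.
rewrite gen_subG; apply/subsetP=> _ /[dup] /(subsetP JS) /imsetP[i _ ->] iJ.
by rewrite inE Bgen_tail //; apply: contraNneq lJ => <-.
Qed.

(* [j] is climbed to [k] one index at a time, without moving larger indices. *)
Lemma climb J (j k : 'I_n) :
  j <= k -> (forall l, j < l <= k -> Bgen l \in J) ->
  exists2 g, g \in <<J>> &
    (forall e, g (j, e) = (k, e)) /\ (forall x, k < x.1 -> g x = x).
Proof.
move def_d: (k - j)%N => d; elim: d => [|d IHd] in k def_d *.
  move=> jk _; exists 1 => //; split=> [e|x _]; rewrite perm1 //.
  by congr (_, _); apply/val_inj/eqP; rewrite eqn_leq jk -subn_eq0 def_d /=.
move=> jk kJ; have ltjk : j < k by rewrite -subn_gt0 def_d.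
have k0 : 0 < k by apply: leq_ltn_trans ltjk.
have pk := val_ord_pred k0.
have [||l /andP[jl lk]|g gJ [gj gfix]] := IHd (ord_pred k).
- by rewrite pk -subn1 subnAC def_d subn1.
- by rewrite pk -ltnS prednK.
- by apply: kJ; rewrite jl (leq_trans lk) // pk leq_pred.
exists (g * Bgen k); first by rewrite groupM // mem_gen // kJ // ltjk leqnn.
split=> [e|x kx]; rewrite permM.
  rewrite gj BgenE /= gtn_eqF //; case: eqP => [pkk|_]; last by rewrite eqxx.
  by have := pk; rewrite pkk => /eqP; rewrite -{1}(prednK k0) gtn_eqF.
by rewrite gfix ?Bgen_fix // pk (leq_ltn_trans (leq_pred _)).
Qed.

(** Descend from [j] to index 0, change the sign there with s_0, and climb to [k]. *)
Lemma climb_neg J (j k : 'I_n) :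
  j <= k -> (forall l, l <= k -> Bgen l \in J) ->
  exists2 g, g \in <<J>> &
    (forall e, g (j, e) = (k, ~~ e)) /\ (forall x, k < x.1 -> g x = x).
Proof.
move=> jk kJ; have n0 : 0 < n by apply: leq_ltn_trans (ltn_ord k).
pose z := Ordinal n0.
have [||g gJ [gj gfix]] := @climb J z j; first exact: leq0n.
  by move=> l /andP[_ lj]; apply/kJ/(leq_trans lj).
have [||h hJ [hk hfix]] := @climb J z k; first exact: leq0n.
  by move=> l /andP[_ lj]; apply/kJ.
exists (g^-1 * Bgen z * h); first by rewrite !groupM ?groupV // mem_gen // kJ.
split=> [e|x kx]; rewrite !permM.
  by rewrite -gj permK BgenE /= ?eqxx hk.
have -> : g^-1 x = x by rewrite -{1}(gfix x) ?permK // (leq_ltn_trans jk).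
by rewrite Bgen_fix ?hfix // (leq_ltn_trans _ kx).
Qed.

Lemma gen_sub_Bgroup J : J \subset Bgens n -> <<J>> \subset Bgroup n.
Proof. by move=> JS; rewrite gen_subG (subset_trans JS Bgens_sub). Qed.

(** Induction on the number of indices that [w] may move: some [g] in [<<J>>] brings the image of
    the last one back. If that image has index j, stability of the tails puts into [J] all s_l with
    j < l <= K, and even all s_l with l <= K if the image is negative; so [climb] or [climb_neg]
    provides [g]. *)
Lemma mem_gen_tail_stable J k w : J \subset Bgens n -> w \in Bgroup n ->
    (forall i, k <= i -> w (i, false) = (i, false)) ->
    (forall l, Bgen l \notin J -> w @: tail l false = tail l false) ->
  w \in <<J>>.
Proof.
move=> JS; elim: k w => [|k IHk] w wB wfix wJ.
  suff -> : w = 1 by apply: group1.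
  apply/permP=> -[i []]; rewrite perm1 ?wfix //.
  by have /BgroupP/(_ i false) /= -> := wB; rewrite wfix.
have [nk|ltkn] := leqP n k; first by apply: IHk => // i /(leq_trans nk); rewrite leqNgt ltn_ord.
pose K := Ordinal ltkn.
have wfix2 i e : k < i -> w (i, e) = (i, e).
  case: e => ki; last exact: wfix.
  by have /BgroupP/(_ i false) /= -> := wB; rewrite wfix.
suff [g gJ [gw gfix]] : exists2 g, g \in <<J>> &
    g (w (K, false)) = (K, false) /\ (forall x, k < x.1 -> g x = x).
  rewrite -(groupMr _ gJ); apply: IHk => [|i|l lJ].
  - by rewrite groupM // (subsetP (gen_sub_Bgroup JS)).
  - rewrite leq_eqVlt permM => /orP[/eqP ki|ki]; last by rewrite wfix2 // gfix.
    by have -> : i = K by apply: val_inj.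
  - by rewrite imset_permM wJ // (gen_tail _ JS lJ gJ).
case wK: (w (K, false)) => [j e].
have jK : j <= K.
  rewrite leqNgt; apply/negP=> Kj; have := wfix2 j e Kj.
  by rewrite -wK => /perm_inj; rewrite wK => -[jK _]; move: Kj; rewrite jK ltnn.
have memw l : l <= K -> Bgen l \notin J -> (j, e) \in tail l false.
  by move=> lK lJ; rewrite -wK (mem_imset_perm _ (wJ _ lJ)) inE /= lK.
case: e wK memw => wK memw; last first.
  have [l /andP[jl lK]|g gJ [gj gfix]] := @climb J j K jK; last by exists g.
  by apply/negPn/negP=> /(memw _ lK); rewrite inE /= andbT leqNgt jl.
have [l lK|g gJ [gj gfix]] := @climb_neg J j K jK; last by exists g.
by apply/negPn/negP=> /(memw _ lK); rewrite inE /= andbF.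
Qed.

Lemma gen_tailP J w : J \subset Bgens n ->
  reflect (w \in Bgroup n /\ forall l, Bgen l \notin J -> w @: tail l false = tail l false)
          (w \in <<J>>).
Proof.
move=> JS; apply: (iffP idP) => [wJ|[wB]]; last first.
  by apply: (@mem_gen_tail_stable J n) => // i; rewrite leqNgt ltn_ord.
split=> [|l lJ]; first exact: subsetP (gen_sub_Bgroup JS) _ wJ.
exact: gen_tail wJ.
Qed.

Lemma gen_Bgens : <<Bgens n>> = Bgroup n.
Proof.
apply/eqP; rewrite eqEsubset gen_sub_Bgroup //=; apply/subsetP=> w wB.
by apply/gen_tailP => //; split=> // l; rewrite imset_f.
Qed.

(* A simple reflection [s_j] changes the size of [A :&: tail l e] only when
   [l = j], and it changes neither of the two sizes for [l = j] only if it
   stabilises [A]. *)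
Lemma Bgen_card i l e (A : {set signed_pt n}) :
  i != l -> #|Bgen i @: A :&: tail l e| = #|A :&: tail l e|.
Proof.
move=> il; rewrite -{1}(Bgen_tail e il) -imsetI; last by move=> ? ? _ _; apply: perm_inj.
exact/card_imset/perm_inj.
Qed.

Lemma Bgen_stab i (A : {set signed_pt n}) :
  (forall e, #|Bgen i @: A :&: tail i e| = #|A :&: tail i e|) -> Bgen i @: A = A.
Proof.
move=> cardA; set s := Bgen i.
have sK : involutive s by apply: BgenK.
have mem_s x : (x \in s @: A) = (s x \in A) by rewrite -{1}(sK x) mem_imset //; apply: perm_inj.
(* The rest of [tail i e] is fixed pointwise by [s], so equal sizes force [s @: A] and [A] to agree
   at [(i, e)]. *)
have iA e : (s (i, e) \in A) = ((i, e) \in A).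
  have := cardA e; rewrite (cardsD1 (i, e)) [in RHS](cardsD1 (i, e)).
  have -> : (s @: A :&: tail i e) :\ (i, e) = (A :&: tail i e) :\ (i, e).
    apply/setP=> -[k e']; rewrite !in_setD1 !in_setI mem_s.
    case: (altP (_ =P (i, e))) => //= neq; case kP: (_ \in tail i e); rewrite ?andbF //.
    move: kP; rewrite inE /= => /andP[ik /eqP ee']; congr (_ && _).
    rewrite /s Bgen_fix // ltn_neqAle ik andbT /=.
    by move: neq; rewrite ee' xpair_eqE eqxx andbT eq_sym.
  move/addIn; rewrite !in_setI mem_s !inE /= leqnn eqxx !andbT.
  by case: (_ \in _) (_ \in _) => [] [].
apply: imset_perm_stable => -[k e] xA; case: (altP (k =P i)) => [ki|ki].
  by rewrite ki iA -ki.
case: (altP (s (k, e) =P (k, e))) => [-> //|sk].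
have skE : s (k, e) = (i, e) by apply: Bgen_moved.
by rewrite skE -iA -skE sK.
Qed.

(** Peel off the first factor s_i. The other factors differ from it, so their product preserves the
    sizes of intersections with [tail i e]; as the whole product stabilises [A], [Bgen_stab] applies
    to s_i, and the remaining product stabilises [A] too. *)
Lemma coxeter_stab K w (A : {set signed_pt n}) : K \subset Bgens n ->
  coxeter_element K w -> w @: A = A -> {in K, forall s : {perm signed_pt n}, s @: A = A}.
Proof.
move=> KS [s sK ->] wA.
have {}wA : (\prod_(y <- s) y) @: A = A by [].
have us : uniq s by rewrite (perm_uniq sK) enum_uniq.
move=> y; rewrite -mem_enum -(perm_mem sK); have {KS} : {subset s <= Bgens n}.
  by move=> z; rewrite (perm_mem sK) mem_enum => /(subsetP KS).
elim: s us wA {sK} y => // z s IHs /= /andP[zs us] + y sS.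
rewrite big_cons imset_permM => wA.
have /imsetP[i _ zi] : z \in Bgens n by apply: sS; rewrite mem_head.
have card_s (B : {set signed_pt n}) e :
    #|(\prod_(y <- s) y) @: B :&: tail i e| = #|B :&: tail i e|.
  have {}sS : {subset s <= Bgens n} by move=> t ts; apply: sS; rewrite inE ts orbT.
  elim: s zs sS B {IHs us wA} => [|t s IHs]; first by rewrite big_nil => _ _ B; rewrite imset_perm1.
  rewrite inE negb_or => /andP[zt zs] sS B; rewrite big_cons imset_permM IHs //.
    have /imsetP[j _ tj] : t \in Bgens n by apply: sS; rewrite mem_head.
    by rewrite tj Bgen_card //; apply: contraNneq zt => ji; rewrite zi tj ji.
  by move=> t' ts; apply: sS; rewrite inE ts orbT.
have zA : z @: A = A.
  by rewrite zi; apply: Bgen_stab => e; rewrite -[in RHS]wA card_s zi.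
rewrite inE => /orP[/eqP-> //|]; apply: IHs => //; first by rewrite -{1}zA.
by move=> t ts; apply: sS; rewrite inE ts orbT.
Qed.

End TypeB.

(** * Fixed points on coset spaces *)

Section FixedCosets.

Variable gT : finGroupType.
Implicit Types (H W : {group gT}) (g x : gT).

Lemma rcoset_afix H W g x : x \in W ->
  (H :* x \in 'Fix_(rcosets H W | 'Rs)[g]) = (x * g * x^-1 \in H).
Proof.
move=> xW; have HW : H :* x \in rcosets H W by apply/rcosetsP; exists x.
rewrite -mem_rcoset inE HW andTb; apply/afix1P/idP => [<-|].
  by rewrite /= rcosetE -rcosetM rcoset_refl.
by move/rcoset_eqP; rewrite rcosetM /= rcosetE.
Qed.

Lemma card_rcosets_fixJ H W g x : x \in W ->
  #|'Fix_(rcosets H W | 'Rs)[g ^ x]| = #|'Fix_(rcosets H W | 'Rs)[g]|.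
Proof.
suff le_fix g' x' : x' \in W ->
    #|'Fix_(rcosets H W | 'Rs)[g']| <= #|'Fix_(rcosets H W | 'Rs)[g' ^ x']|.
  move=> xW; apply/eqP; rewrite eqn_leq le_fix // andbT.
  by rewrite -{2}(conjgK x g) le_fix ?groupV.
move=> xW; rewrite -(card_imset _ (act_inj 'Rs x')); apply: subset_leq_card.
apply/subsetP=> _ /imsetP[C /setIP[WC /afix1P Cg] ->].
rewrite inE (acts_act (actsRs_rcosets H W)) // WC /=.
by apply/afix1P; rewrite -actM -conjgC actM Cg.
Qed.

(** The [p]-part of [g] generates a [p]-group commuting with the p'-part, so it acts on the cosets
    fixed by the latter; those it fixes are the ones fixed by [g]. *)
Lemma card_rcosets_fix_constt p H W g : prime p -> g \in W ->
  #|'Fix_(rcosets H W | 'Rs)[g]| = #|'Fix_(rcosets H W | 'Rs)[g.`_p^']| %[mod p].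
Proof.
move=> p_pr gW; apply/esym.
have pP : p.-group <[g.`_p]> by apply: p_elt_constt.
have xW pi : g.`_pi \in W.
  by apply: (subsetP _ _ (cycle_constt pi g)); rewrite cycle_subG.
have actP : [acts <[g.`_p]>, on 'Fix_(rcosets H W | 'Rs)[g.`_p^'] | 'Rs].
  rewrite cycle_subG !inE /=; apply/subsetP=> C /setIP[WC /afix1P Cg].
  rewrite !inE (acts_act (actsRs_rcosets H W)) // WC /=.
  apply/subsetP=> _ /set1P ->; rewrite inE; apply/eqP.
  by rewrite -actM (commuteX2 _ _ (commute_refl g) : commute _ _) actM Cg.
have := pgroup_fix_mod pP actP; rewrite afix_cycle => ->; congr (_ %% _).
apply: eq_card => C; apply/setIP/setIP=> [[/setIP[WC /afix1P Cg'] /afix1P Cg]|[WC Cg]].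
  by split=> //; apply/afix1P; rewrite -(consttC p g) actM Cg.
have Cpi pi : C \in afix 'Rs [set g.`_pi].
  rewrite -afix_cycle in Cg.
  by apply: subsetP Cg; apply: afixS; rewrite sub1set cycle_constt.
by rewrite inE WC !Cpi.
Qed.

(** The map [amove] sends a point z of the orbit to the coset of all a in [W] carrying [y] to z, and
    this identification is equivariant. *)
Lemma card_rcosets_fix_orbit (rT : finType) (to : {action gT &-> rT}) W y g :
  g \in W ->
  #|'Fix_(rcosets 'C_W[y | to] W | 'Rs)[g]| = #|'Fix_(orbit to W y | to)[g]|.
Proof.
move=> gW; have WD := subsetT W.
have injm : {in 'Fix_(orbit to W y | to)[g] &, injective (amove to W y)}.
  by move=> z z' /setIP[zW _] /setIP[zW' _]; apply: (can_in_inj (amoveK WD)).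
rewrite -(card_in_imset injm); apply: eq_card => C; apply/idP/idP.
  move=> Cg; have /setIP[/rcosetsP[a aW def_C] _] := Cg; move: Cg.
  rewrite def_C rcoset_afix // => /setIP[_ /astab1P yg].
  apply/imsetP; exists (to y a); last by rewrite amove_act.
  rewrite inE mem_orbit //=; apply/afix1P.
  by rewrite -actM -{2}yg -actM mulgKV.
case/imsetP=> _ /setIP[/orbitP[a aW <-] /afix1P yg] ->.
rewrite amove_act // rcoset_afix //.
apply/setIP; split; first by rewrite !groupM ?groupV.
apply/astab1P.
by rewrite !actM yg actK.
Qed.

End FixedCosets.

(** * Marks as numbers of fixed points of Coxeter elements *)

Section TypeB.

Variable n : nat.
Implicit Types (J K : {set {perm signed_pt n}}) (w : {perm signed_pt n}).

Lemma coxeter_gen K w : coxeter_element K w -> w \in <<K>>.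
Proof.
case=> s sK ->; rewrite big_seq group_prod // => y.
by rewrite (perm_mem sK) mem_enum; apply: mem_gen.
Qed.

Lemma coxeter_Bgroup K w : K \subset Bgens n -> coxeter_element K w -> w \in Bgroup n.
Proof. by move=> KS /coxeter_gen; apply/subsetP/gen_sub_Bgroup. Qed.

(** A coset [<<J>> :* a] is fixed by [w] exactly when [w] stabilises the images under [a] of the
    sets [tail l false] with [Bgen l] outside [J]. By [coxeter_stab], each element of [K] then
    stabilises them as well. *)
Lemma mark_coxeter J K w :
    J \subset Bgens n -> K \subset Bgens n -> coxeter_element K w ->
  mark (Bgroup n) J K = #|'Fix_(rcosets <<J>> (Bgroup n) | 'Rs)[w]|.
Proof.
move=> JS KS wK; have KB := gen_sub_Bgroup KS.
have wgen := coxeter_gen wK.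
apply: eq_card => C; apply/idP/idP.
  by case/setIP=> WC CK; rewrite inE WC (subsetP (afixS _ _) _ CK) ?sub1set.
move=> Cw; have /setIP[WC _] := Cw; have /rcosetsP[a aB def_C] := WC.
move: Cw; rewrite def_C rcoset_afix // => /gen_tailP[] // _ awJ.
rewrite inE -def_C WC /= afix_gen; apply/afixP=> y yK.
have yB : y \in Bgroup n by rewrite (subsetP KB) ?mem_gen.
apply/afix1P; suff: C \in 'Fix_(rcosets <<J>> (Bgroup n) | 'Rs)[y] by case/setIP.
rewrite def_C rcoset_afix //; apply/gen_tailP => //.
split=> [|l lJ]; first by rewrite !groupM ?groupV.
rewrite !imset_permM (coxeter_stab KS wK _ yK).
  by rewrite -imset_permM mulgV imset_perm1.
by rewrite -{2}(awJ l lJ) -!imset_permM mulgKV.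
Qed.

Lemma mark_constt p J K w : prime p ->
    J \subset Bgens n -> K \subset Bgens n -> coxeter_element K w ->
  mark (Bgroup n) J K = #|'Fix_(rcosets <<J>> (Bgroup n) | 'Rs)[w.`_p^']| %[mod p].
Proof.
move=> p_pr JS KS wK; rewrite (mark_coxeter JS KS wK); apply: card_rcosets_fix_constt => //.
exact: coxeter_Bgroup wK.
Qed.

End TypeB.

(** * Maximal parabolic subgroups and isotropic sets *)

Lemma exists_perm_imset (T : finType) (A B : {set T}) :
  #|A| = #|B| -> exists s : {perm T}, s @: A = B.
Proof.
(* Each set is listed before its complement; the permutation matches positions in the two lists. *)
move=> AB; pose e (C : {set T}) := enum C ++ enum (~: C).
have e_uniq C : uniq (e C).
  rewrite cat_uniq !enum_uniq andbT; apply/hasPn=> x.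
  by rewrite /= !mem_enum inE.
have mem_e C x : x \in e C by rewrite mem_cat !mem_enum inE orbN.
have size_e C : size (e C) = #|T| by rewrite size_cat -!cardE cardsC.
pose f x := nth x (e B) (index x (e A)).
have f_inj : injective f.
  move=> x y /eqP; rewrite /f (set_nth_default y) ?size_e -?(size_e A) ?index_mem //.
  rewrite nth_uniq ?e_uniq ?size_e -?(size_e A) ?index_mem // => /eqP.
  by move/(congr1 (nth x (e A))); rewrite !nth_index.
exists (perm f_inj); apply/eqP; rewrite eqEcard card_imset -?AB ?leqnn ?andbT; last exact: perm_inj.
apply/subsetP=> _ /imsetP[x xA ->]; rewrite permE /f index_cat mem_enum xA nth_cat.
have ltx : index x (enum A) < size (enum B) by rewrite -cardE -AB cardE index_mem mem_enum.
by rewrite ltx -mem_enum mem_nth.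
Qed.

Definition isotropic (T : finType) (o : {perm T}) (A : {set T}) :=
  [forall x in A, o x \notin A].

Section TypeB.

Variable n : nat.
Implicit Types (l : 'I_n) (J K : {set {perm signed_pt n}}) (w : {perm signed_pt n}).
Implicit Types (E : {set {set {perm signed_pt n}}}).

Local Notation W := (Bgroup n).
Local Notation S := (Bgens n).

Lemma gen_max_stab l : <<S :\ Bgen l>> = 'C_W[tail l false | 'P^*].
Proof.
apply/setP=> w; apply/gen_tailP/setIP => [|[wB wl]|[wB /astab1P wl]]; first exact: subsetDl.
  split=> //; apply/astab1P; apply: wl; by rewrite setD11.
split=> // k kS; have -> : k = l; last exact: wl.
by apply/eqP; move: kS; rewrite !inE imset_f // andbT negbK => /eqP/Bgen_inj->.
Qed.

Lemma card_ord_geq l : #|[set i : 'I_n | l <= i]| = n - l.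
Proof.
rewrite -sum1_card (eq_bigl _ _ (fun i => in_set _ i)).
by rewrite -(big_geq_mkord l n xpredT (fun=> 1%N)) sum_nat_const_nat muln1.
Qed.

Lemma card_tail l e : #|tail l e| = n - l.
Proof.
have -> : tail l e = [set (i, e) | i in [set i : 'I_n | l <= i]].
  apply/setP=> -[i e']; rewrite !inE /=; apply/andP/imsetP=> [[li /eqP->]|[j]].
    by exists i; rewrite ?inE.
  by rewrite inE => lj [-> ->].
by rewrite card_imset ?card_ord_geq // => i j [].
Qed.

(** An isotropic set has at most one point over each index, so it is a set of indices with signs:
    [s] moves the indices from [l] on onto those of [A], and [f] also adjusts the signs. *)
Lemma orbit_tail l : orbit 'P^* W (tail l false) =
  [set A | isotropic (opp_perm n) A & #|A| == (n - l)%N].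
Proof.
apply/setP=> A; rewrite inE; apply/orbitP/andP=> [[w wB <-]|[/forall_inP isoA /eqP cardA]].
  split; last by rewrite card_imset ?card_tail //; apply: perm_inj.
  apply/forall_inP=> _ /imsetP[x xl ->]; rewrite /= apermE.
  have /cent1P oC := wB; rewrite -permM oC permM mem_imset; last exact: perm_inj.
  by move: xl; rewrite permE !inE /= => /andP[_ /eqP->]; rewrite andbF.
have fst_inj : {in A &, injective fst}.
  move=> [i e] [j e'] iA jA /= eq_ij; rewrite -eq_ij in jA *; congr (_, _).
  apply/eqP; rewrite -[_ == _]negbK -addbN; apply/negP.
  have := isoA _ iA; rewrite permE /opp_pt /=.
  by case: e e' iA jA => [] [] //= iA -> .
pose I := [set fst x | x in A].
have [s sI] : exists s : {perm 'I_n}, s @: [set i : 'I_n | l <= i] = I.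
  by apply: exists_perm_imset; rewrite card_in_imset // cardA card_ord_geq.
pose f (x : signed_pt n) : signed_pt n := (s x.1, x.2 (+) ((s x.1, true) \in A)).
have f_inj : injective f by move=> [i e] [j e'] [/perm_inj-> /addIb->].
exists (perm f_inj).
  by apply/BgroupP=> i e; rewrite !permE /f /opp_pt /= addNb.
apply/eqP; rewrite eqEcard card_imset ?card_tail ?cardA ?leqnn ?andbT; last exact: perm_inj.
apply/subsetP=> _ /imsetP[[i e] xl ->]; move: xl; rewrite inE /= apermE permE => /andP[li /eqP->].
rewrite /f /=; have : s i \in I by rewrite -sI imset_f ?inE.
case/imsetP=> -[j e'] jA /= sij; move: jA; rewrite -sij.
by case: e' => jA; [rewrite jA | case sA: ((s i, true) \in A)].
Qed.

(** A conjugate is allowed because [E] contains only some representative of the class of a maximal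
    subset. Conjugating replaces the tail by a translate, which has the same orbit. *)
Lemma card_fix_maximal_parabolic l J w : w \in W -> J \in (S :\ Bgen l) :^: W ->
  #|'Fix_(rcosets <<J>> W | 'Rs)[w]| =
  #|[set A | [&& isotropic (opp_perm n) A, #|A| == (n - l)%N & w @: A == A]]|.
Proof.
move=> wW /imsetP[x xW ->]; rewrite genJ gen_max_stab conjIg conjGid // -astab1_act ?inE //.
rewrite card_rcosets_fix_orbit // orbit_act // orbit_tail.
by apply: eq_card => A; rewrite !inE -andbA sub1set inE.
Qed.

(** * Class representatives and the prime 2 *)

Lemma reps_exists E J : subset_class_reps W S E -> J \subset S ->
  exists2 J', J' \in E & J' \in J :^: W.
Proof.
case/and3P=> _ _ /forall_inP trE JS.
have BE : [set K in powerset S | K \in J :^: W] \in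
    equivalence_partition (fun J K => K \in J :^: W) (powerset S).
  by apply/imsetP; exists J; rewrite ?powersetE.
have /trE/cards1P[J' EB] := BE.
have : J' \in [set J'] by rewrite inE.
by rewrite -EB !inE => /and3P[J'E _ J'J]; exists J'.
Qed.

Lemma reps_sub E J : subset_class_reps W S E -> J \in E -> J \subset S.
Proof. by case/and3P=> _ /subsetP ES _ /ES; rewrite powersetE. Qed.

(** The representative of the class of [S] is a subset of [S] with as many elements. *)
Lemma Bgens_reps E : subset_class_reps W S E -> S \in E.
Proof.
move=> E_reps; have [J JE /imsetP[w _ JS]] := reps_exists E_reps (subxx S).
suff <- : J = S by [].
by apply/eqP; rewrite eqEcard (reps_sub E_reps JE) JS cardJg /=.
Qed.

Lemma opp_perm_in : opp_perm n \in W.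
Proof. by rewrite /= cent1id. Qed.

(** For s_l outside [J], [<<J>>] stabilises [tail l false], whereas -1 sends it to [tail l true]. *)
Lemma opp_perm_notin J : J \proper S -> opp_perm n \notin <<J>>.
Proof.
move=> /[dup] /proper_sub JS /properP[_ [_ /imsetP[l _ ->] lJ]].
apply/negP=> /(gen_tail false JS lJ)/(mem_imset_perm (l, false)).
by rewrite permE !inE /= leqnn.
Qed.

Lemma even_mark J K : J \proper S -> K \subset S -> 2 %| mark W J K.
Proof.
move=> ltJS KS; have JW := gen_sub_Bgroup (proper_sub ltJS).
have oW := opp_perm_in; have oP : 2.-group <[opp_perm n]>.
  apply: (@pnat_dvd _ (2 ^ 1)); last by rewrite pnatX.
  rewrite order_dvdn; apply/eqP/permP=> x.
  by rewrite expgS expg1 permM !permE /opp_pt /= negbK; case: x.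
pose F := 'Fix_(rcosets <<J>> W | 'Rs)(<<K>>).
have actF : [acts <[opp_perm n]>, on F | 'Rs].
  rewrite cycle_subG !inE /=; apply/subsetP=> C /setIP[WC /afixP CK].
  rewrite !inE (acts_act (actsRs_rcosets <<J>> W)) // WC /=.
  apply/subsetP=> k kK; rewrite inE -actM.
  have kW : k \in W by apply: subsetP (gen_sub_Bgroup KS) _ kK.
  by have /cent1P <- := kW; rewrite actM CK.
have := pgroup_fix_mod oP actF; rewrite -/F /dvdn => ->.
suff -> : 'Fix_(F | 'Rs)(<[opp_perm n]>) = set0 by rewrite cards0.
apply/eqP; rewrite -subset0; apply/subsetP=> C; rewrite afix_cycle.
case/setIP=> /setIP[/[dup] WC /rcosetsP[a aW def_C] _] Co.
have: C \in 'Fix_(rcosets <<J>> W | 'Rs)[opp_perm n] by rewrite inE WC.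
rewrite def_C rcoset_afix //; have /cent1P -> := aW.
by rewrite mulgK (negPf (opp_perm_notin ltJS)).
Qed.

Lemma mark_Bgens K : K \subset S -> mark W S K = 1%N.
Proof.
move=> KS; rewrite /mark gen_Bgens rcosets_id.
suff -> : 'Fix_([set W : {set _}] | 'Rs)(<<K>>) = [set W : {set _}] by rewrite cards1.
apply/setIidPl; rewrite sub1set; apply/afixP=> k kK /=.
by rewrite rcosetE rcoset_id // (subsetP (gen_sub_Bgroup KS)).
Qed.

Lemma nonzero_rows2 E : subset_class_reps W S E -> nonzero_rows W 2 E = [set S].
Proof.
move=> E_reps; have SE := Bgens_reps E_reps; apply/setP=> J; rewrite !inE.
have [->|JS] := eqVneq J S.
  by rewrite SE; apply/exists_inP; exists S; rewrite ?mark_Bgens.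
apply/andP=> -[JE /exists_inP[K KE]].
by rewrite even_mark ?properEneq ?JS ?(reps_sub E_reps).
Qed.

Lemma decomp2 E K : subset_class_reps W S E -> K \in E -> decomp W 2 E K S = 1%N.
Proof.
move=> E_reps KE; rewrite /decomp; case: forall_inP => // -[] J JE.
have [->|JS] := eqVneq J S; first by rewrite !mark_Bgens // (reps_sub E_reps).
have ltJS : J \proper S by rewrite properEneq JS (reps_sub E_reps).
have /eqP -> := even_mark ltJS (reps_sub E_reps KE).
by have /eqP -> := even_mark ltJS (subxx S).
Qed.

End TypeB.

(** * Permutations commuting with an involution *)

Lemma permX_eqE (T : finType) (u : {perm T}) x i :
  ((u ^+ i) x == x) = (#|porbit u x| %| i).
Proof.
set m := #|_|; have m0 : 0 < m by apply/card_gt0P; exists x; apply: porbit_id.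
have fixm q : (u ^+ (q * m)) x = x.
  elim: q => [|q IHq]; first by rewrite perm1.
  by rewrite mulSn expgD permM -[RHS]IHq; congr (_ _); rewrite permX iter_porbit.
rewrite {1}(divn_eq i m) expgD permM fixm permX /dvdn.
have rm : i %% m < m by rewrite ltn_mod.
have := nth_uniq x (i := i %% m) (j := 0) _ _ (uniq_traject_porbit u x).
by rewrite size_traject !nth_traject //; apply.
Qed.

Section Involution.

Variables (T : finType) (o : {perm T}).
Hypothesis oK : involutive o.
Implicit Types (u w : {perm T}) (x y z : T) (A D : {set T}).

(** These are the cycles equal to their opposites, known as negative cycles of a signed
    permutation. *)
Definition negative_orbit u x := o x \in porbit u x.
Definition orbit_type u x := (#|porbit u x|, negative_orbit u x).
(** When [u] commutes with [o], this is the orbit of [x] under the group generated by both. *)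
Definition sym_orbit u x := porbit u x :|: porbit u (o x).

Lemma commX u i x : commute u o -> o ((u ^+ i) x) = (u ^+ i) (o x).
Proof. by move=> uo; rewrite -!permM (commuteX i (commute_sym uo)). Qed.

Lemma mem_porbit_o u x y : commute u o -> (o x \in porbit u (o y)) = (x \in porbit u y).
Proof.
move=> uo; apply/porbitP/porbitP=> [[i]|[i ->]]; exists i; last by rewrite commX.
by apply: (@perm_inj _ o); rewrite commX.
Qed.

Lemma porbit_o u x : commute u o -> porbit u (o x) = o @: porbit u x.
Proof.
move=> uo; apply/setP=> y; rewrite -{1}(oK y) mem_porbit_o //.
by rewrite -{2}(oK y) mem_imset //; apply: perm_inj.
Qed.

Lemma card_porbit_o u x : commute u o -> #|porbit u (o x)| = #|porbit u x|.
Proof. by move=> uo; rewrite porbit_o // card_imset //; apply: perm_inj. Qed.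

Lemma mem_sym_o u x y : commute u o -> (o y \in sym_orbit u x) = (y \in sym_orbit u x).
Proof.
move=> uo; rewrite !inE mem_porbit_o // orbC; congr (_ || _).
by rewrite -{1}(oK x) mem_porbit_o.
Qed.

Lemma porbit_permX u i x y : ((u ^+ i) y \in porbit u x) = (y \in porbit u x).
Proof. by rewrite ![_ \in porbit u x]porbit_sym porbit_perm. Qed.

Lemma mem_sym_perm u x y : (u y \in sym_orbit u x) = (y \in sym_orbit u x).
Proof.
by have := porbit_permX u 1; rewrite expg1 !inE => ->; rewrite -{2}(expg1 u) porbit_permX.
Qed.

Lemma sym_orbit_id u x : x \in sym_orbit u x.
Proof. by rewrite inE porbit_id. Qed.

Lemma sym_orbit_type u x y : commute u o ->
  y \in sym_orbit u x -> orbit_type u y = orbit_type u x.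
Proof.
move=> uo; have type_porbit z t : z \in porbit u t -> orbit_type u z = orbit_type u t.
  move=> zt; have zt' := zt; rewrite -eq_porbit_mem in zt'.
  rewrite /orbit_type /negative_orbit (eqP zt'); congr (_, _).
  rewrite -!eq_porbit_mem porbit_o // (eqP zt') -porbit_o //.
case/setUP => [/type_porbit // | /type_porbit ->].
by rewrite /orbit_type /negative_orbit mem_porbit_o // card_porbit_o.
Qed.

Lemma card_sym_orbit u x : commute u o ->
  #|sym_orbit u x| = if negative_orbit u x then #|porbit u x| else (#|porbit u x| * 2)%N.
Proof.
move=> uo; rewrite /sym_orbit /negative_orbit; case: ifPn => [|ox].
  by rewrite -eq_porbit_mem => /eqP->; rewrite setUid.
rewrite cardsU card_porbit_o // muln2 -addnn -[RHS]subn0; congr (_ - _).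
apply/eqP; rewrite cards_eq0 -subset0; apply/subsetP=> z /setIP[zx].
rewrite -eq_porbit_mem; move: zx; rewrite -eq_porbit_mem => /eqP->.
by rewrite eq_sym eq_porbit_mem (negPf ox).
Qed.

Lemma sym_orbit_sub u x D : {in D, forall z, u z \in D /\ o z \in D} -> x \in D ->
  sym_orbit u x \subset D.
Proof.
move=> closD xD; have closX i z : z \in D -> (u ^+ i) z \in D.
  move=> zD; elim: i => [|i IHi]; first by rewrite perm1.
  by rewrite expgSr permM; case: (closD _ IHi).
apply/subsetP=> z /setUP[] /porbitP[i ->]; apply: closX => //.
by case: (closD _ xD).
Qed.

Lemma closedD_sym_orbit u x D : commute u o -> {in D, forall z, u z \in D /\ o z \in D} ->
  {in D :\: sym_orbit u x,
     forall z, u z \in D :\: sym_orbit u x /\ o z \in D :\: sym_orbit u x}.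
Proof.
move=> uo closD z /setDP[zD zU]; have [uD oD] := closD z zD.
by rewrite !in_setD mem_sym_perm mem_sym_o // zU uD oD.
Qed.

(** Bookkeeping for the inductions that remove one symmetric orbit at a time: the type is constant
    on it, so only one type loses points. *)
Lemma card_type_sym_orbit u x D t : commute u o ->
    {in D, forall z, u z \in D /\ o z \in D} -> x \in D ->
  #|[set z in D | orbit_type u z == t]| =
    (#|[set z in D :\: sym_orbit u x | orbit_type u z == t]| +
     (if t == orbit_type u x then #|sym_orbit u x| else 0))%N.
Proof.
move=> uo closD xD; rewrite -(cardsID (sym_orbit u x)) addnC; congr (_ + _)%N.
  by apply: eq_card => z; rewrite !inE andbA.
case: eqP => [->|tx].
  apply: eq_card => z; rewrite !inE; apply/andP/idP=> [[]|zU] //.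
  rewrite (subsetP (sym_orbit_sub closD xD)) ?inE //=; split=> //.
  by apply/eqP/sym_orbit_type; rewrite ?inE.
apply/eqP; rewrite cards_eq0 -subset0; apply/subsetP=> z; rewrite inE => /andP[].
rewrite inE => /andP[_ /eqP zt] zU.
by case: tx; rewrite -zt (sym_orbit_type uo zU).
Qed.

End Involution.

(** * Conjugacy in the centraliser of a fixed-point-free involution *)

Section Conjugacy.

Variables (T : finType) (o : {perm T}).
Hypotheses (oK : involutive o) (o_free : forall x, o x != x).
Implicit Types (u w : {perm T}) (x y z : T) (A D : {set T}).

Local Notation orbit_type := (orbit_type o).
Local Notation sym_orbit := (sym_orbit o).

(** The pair (i, b) stands for the element o^b u^i of the group generated by [u] and [o]. *)
Definition signed_act u x (k : nat * bool) :=
  if k.2 then o ((u ^+ k.1) x) else (u ^+ k.1) x.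

(** Both 2 i and 2 k are odd multiples of [m], so 2 (i + k) is an even one. *)
Lemma double_dvdn m i k : m %| 2 * i -> m %| 2 * k -> ~~ (m %| i) -> ~~ (m %| k) ->
  m %| i + k.
Proof.
case: (posnP m) => [-> |m0]; first by rewrite !dvd0n !muln_eq0 /= => ->.
case/dvdnP=> a ia /dvdnP[b kb].
have odd_q c j : (2 * j = c * m)%N -> ~~ (m %| j) -> odd c.
  move=> jc; apply: contraR => /even_halfK c2; apply/dvdnP; exists c./2.
  by apply/eqP; rewrite -(eqn_pmul2l (isT : 0 < 2)) jc -{1}c2 -mul2n mulnA.
move=> /(odd_q _ _ ia) oa /(odd_q _ _ kb) ob.
apply/dvdnP; exists (a + b)./2; apply/eqP.
rewrite -(eqn_pmul2l (isT : 0 < 2)) mulnDr ia kb -mulnDl mulnA mul2n even_halfK //.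
by rewrite oddD oa ob.
Qed.

(** In a negative orbit of length m, o x = u^k x with k an odd multiple of m / 2, since [o] has no
    fixed point; so o u^i fixes [x] exactly when i is such a multiple. Hence the stabiliser of [x]
    depends only on the orbit type. *)
Lemma signed_act_fix u x i b : commute u o ->
  (signed_act u x (i, b) == x) =
  if b then [&& negative_orbit o u x, #|porbit u x| %| 2 * i & ~~ (#|porbit u x| %| i)]
  else #|porbit u x| %| i.
Proof.
move=> uo; rewrite /signed_act /=; case: b => /=; last exact: permX_eqE.
apply/eqP/and3P=> [oux|[/porbitP[k ok] i2 i1]].
  have uox : (u ^+ i) x = o x by rewrite -{2}oux oK.
  split; first by rewrite /negative_orbit -uox mem_porbit.
    by rewrite -permX_eqE mul2n -addnn expgD permM uox -commX // uox oK.
  by rewrite -permX_eqE uox o_free.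
have k1 : ~~ (#|porbit u x| %| k) by rewrite -permX_eqE -ok o_free.
have k2 : #|porbit u x| %| 2 * k.
  by rewrite -permX_eqE mul2n -addnn expgD permM -ok -commX // -ok oK.
by rewrite commX // ok -permM -expgD addnC; apply/eqP; rewrite permX_eqE double_dvdn.
Qed.

Lemma signed_act_eq u x N i j a b : commute u o -> 0 < N -> u ^+ N = 1 ->
  (signed_act u x (i, a) == signed_act u x (j, b)) =
  (signed_act u x (i + j * N.-1, a (+) b)%N == x).
Proof.
move=> uo N0 uN; rewrite /signed_act /= expgD permM.
(* As u^N = 1, the power u^(j (N - 1)) is the inverse of u^j. *)
set X := (u ^+ i) x; set Y := (u ^+ j) x; set v := u ^+ (j * N.-1).
have vY : v Y = x.
  by rewrite -permM -expgD -{1}(muln1 j) -mulnDr add1n prednK // mulnC expgM uN expg1n perm1.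
have vo z : o (v z) = v (o z) by apply: commX.
have vx z : (v z == x) = (z == Y) by rewrite -vY (inj_eq (@perm_inj _ v)).
case: a b => [] [] /=; rewrite ?vo vx ?(inj_eq (@perm_inj _ o)) //.
by rewrite -{1}(oK X) (inj_eq (@perm_inj _ o)).
Qed.

Lemma signed_act_eq_type u w x y k k' : commute u o -> commute w o ->
    orbit_type u x = orbit_type w y ->
  (signed_act u x k == signed_act u x k') = (signed_act w y k == signed_act w y k').
Proof.
case: k k' => [i a] [j b] uo wo [card_xy neg_xy].
(* A common exponent of [u] and [w] gives the same exponent i + j (N - 1) on both sides. *)
have N0 : 0 < #[u] * #[w] by rewrite muln_gt0 !order_gt0.
rewrite (signed_act_eq _ _ _ _ _ uo N0); last by rewrite expgM expg_order expg1n.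
rewrite (signed_act_eq _ _ _ _ _ wo N0); last by rewrite mulnC expgM expg_order expg1n.
by rewrite !signed_act_fix // neg_xy card_xy.
Qed.

Lemma sym_orbitP u x z : commute u o ->
  reflect (exists k : 'I_#[u] * bool, z = signed_act u x (val k.1, k.2)) (z \in sym_orbit u x).
Proof.
move=> uo; apply: (iffP setUP) => [[]/porbitP[i ->]|[[i []] ->]]; rewrite /signed_act /=.
- have lti : i %% #[u] < #[u] by rewrite ltn_mod.
  by exists (Ordinal lti, false); rewrite /= expg_mod_order.
- have lti : i %% #[u] < #[u] by rewrite ltn_mod.
  by exists (Ordinal lti, true); rewrite /= expg_mod_order commX.
- by right; rewrite commX // mem_porbit.
by left; rewrite mem_porbit.
Qed.

(* Induction on [#|D|]: a symmetric orbit of [D] is sent to one of [D'] of the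
   same type, and both are removed. *)
Lemma equivariant_extension u w N D D' : commute u o -> commute w o -> #|D| < N ->
    {in D, forall z, u z \in D /\ o z \in D} ->
    {in D', forall z, w z \in D' /\ o z \in D'} ->
    (forall t, #|[set z in D | orbit_type u z == t]| =
               #|[set z in D' | orbit_type w z == t]|) ->
  exists2 h : T -> T, {in D &, injective h} &
    {in D, forall z, [/\ h z \in D', h (u z) = w (h z) & h (o z) = o (h z)]}.
Proof.
move=> uo wo; elim: N D D' => // N IHN D D' ltDN closD closD' card_type.
have [->|[x xD]] := set_0Vmem D.
  by exists id => [z t|z]; rewrite inE.
have [y yD' xy] : exists2 y, y \in D' & orbit_type w y = orbit_type u x.
  have : 0 < #|[set z in D' | orbit_type w z == orbit_type u x]|.
    by rewrite -card_type; apply/card_gt0P; exists x; rewrite inE xD eqxx.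
  by case/card_gt0P=> y; rewrite inE => /andP[yD /eqP]; exists y.
have cUU' : #|sym_orbit u x| = #|sym_orbit w y|.
  by rewrite !card_sym_orbit //; case: xy => -> ->.
have [||||h0 h0_inj h0P] := IHN (D :\: sym_orbit u x) (D' :\: sym_orbit w y).
- rewrite -ltnS; apply: leq_trans ltDN; rewrite ltnS; apply: proper_card.
  rewrite properE subsetDl; apply/subsetPn; exists x => //.
  by rewrite inE sym_orbit_id.
- exact: closedD_sym_orbit.
- exact: closedD_sym_orbit.
- move=> t; have := card_type t.
  rewrite (card_type_sym_orbit oK t uo closD xD) (card_type_sym_orbit oK t wo closD' yD').
  by rewrite xy cUU'; apply: addIn.
(* On the removed orbit, o^b u^i x goes to o^b w^i y; by [signed_act_eq_type] the choice of (i, b)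
   does not matter. *)
pose h z := if [pick k : 'I_#[u] * bool | z == signed_act u x (val k.1, k.2)] is Some k
  then signed_act w y (val k.1, k.2) else h0 z.
have hU k : h (signed_act u x k) = signed_act w y k.
  rewrite /h; case: pickP => [k'|none]; last first.
    have /(sym_orbitP _ _ uo)[k' kk'] : signed_act u x k \in sym_orbit u x.
      by case: k {none} => i []; rewrite /signed_act /= ?commX // inE mem_porbit ?orbT.
    by have := none k'; rewrite kk' eqxx.
  rewrite (signed_act_eq_type _ _ uo wo (esym xy)) => /eqP-> //.
have hD z : z \notin sym_orbit u x -> h z = h0 z.
  move=> zU; rewrite /h; case: pickP => // k /eqP zk.
  by case/sym_orbitP: zU => //; exists k.
have signed_actU k : signed_act w y k \in sym_orbit w y.
  by case: k => i []; rewrite /signed_act /= ?commX // inE mem_porbit ?orbT.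
have UD' := subsetP (sym_orbit_sub closD' yD').
exists h => [z t zD tD|z zD]; last first.
  have [/(sym_orbitP _ _ uo)[[i b] ->]|zU] := boolP (z \in sym_orbit u x).
    have uE : u (signed_act u x (val i, b)) = signed_act u x (i.+1, b).
      by rewrite /signed_act /= expgSr permM; case: {+}b => //; rewrite -!permM uo.
    have wE : w (signed_act w y (val i, b)) = signed_act w y (i.+1, b).
      by rewrite /signed_act /= expgSr permM; case: {+}b => //; rewrite -!permM wo.
    have oE v t : o (signed_act v t (val i, b)) = signed_act v t (val i, ~~ b).
      by rewrite /signed_act /=; case: {+}b; rewrite ?oK.
    by rewrite /= uE oE !hU wE oE; split=> //; apply: UD'.
  have [|/setDP[hD' _] hu ho] := h0P z; first by rewrite inE zU.
  by rewrite !hD ?mem_sym_perm ?mem_sym_o.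
have [zU|zU] := boolP (z \in sym_orbit u x); have [tU|tU] := boolP (t \in sym_orbit u x).
- have /(sym_orbitP _ _ uo)[k ->] := zU; have /(sym_orbitP _ _ uo)[k' ->] := tU.
  by rewrite !hU => /eqP; rewrite -(signed_act_eq_type _ _ uo wo (esym xy)) => /eqP.
- have /(sym_orbitP _ _ uo)[k ->] := zU; rewrite hU hD // => eq_h.
  have [|/setDP[_]] := h0P t; first by rewrite inE tU.
  by rewrite -eq_h signed_actU.
- have /(sym_orbitP _ _ uo)[k ->] := tU; rewrite hU hD // => eq_h.
  have [|/setDP[_]] := h0P z; first by rewrite inE zU.
  by rewrite eq_h signed_actU.
by rewrite !hD // => /h0_inj; apply; rewrite inE ?zU ?tU.
Qed.

(** An equivariant injection of [T] into itself is a permutation that commutes with [o] and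
    conjugates [u] to [w]. *)
Lemma conj_of_orbit_types u w : commute u o -> commute w o ->
    (forall t, #|[set z | orbit_type u z == t]| = #|[set z | orbit_type w z == t]|) ->
  w \in u ^: 'C[o].
Proof.
move=> uo wo card_t; have [|||t|h h_inj hP] := @equivariant_extension u w #|T|.+1 setT setT uo wo.
- by rewrite cardsT.
- by move=> z _; rewrite !inE.
- by move=> z _; rewrite !inE.
- have eqT v : [set z in [set: T] | orbit_type v z == t] = [set z | orbit_type v z == t].
    by apply/setP=> z; rewrite !inE.
  by rewrite !eqT.
have {}h_inj : injective h by move=> z t; apply: h_inj; rewrite inE.
have {}hP z := hP z (in_setT z).
apply/imsetP; exists (perm h_inj).
  by apply/cent1P/permP=> z; rewrite !permM !permE; case: (hP z).
rewrite conjgE; apply: (mulgI (perm h_inj)); rewrite mulKVg.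
by apply/permP=> z; rewrite !permM !permE; case: (hP z).
Qed.

End Conjugacy.

(** * Counting stable isotropic sets *)

Section IsotropicPoly.

Variables (T : finType) (o : {perm T}).
Hypothesis oK : involutive o.
Implicit Types (u w : {perm T}) (x y z : T) (A D : {set T}).

Lemma porbit_sub_stable u x A : u @: A = A -> x \in A -> porbit u x \subset A.
Proof.
move=> uA xA; apply/subsetP=> _ /porbitP[i ->].
by elim: i => [|i IHi]; rewrite ?perm1 // expgSr permM mem_imset_perm.
Qed.

Lemma porbit_stable u x : u @: porbit u x = porbit u x.
Proof.
by apply: imset_perm_stable => z; rewrite -{2}(expg1 u) porbit_permX.
Qed.

Definition stable_isotropic u D A := [&& A \subset D, isotropic o A & u @: A == A].

Lemma stable_isotropic_notin u D A x : commute u o ->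
    {in D, forall z, u z \in D /\ o z \in D} -> x \in D ->
  stable_isotropic u (D :\: sym_orbit o u x) A =
  [&& stable_isotropic u D A, x \notin A & o x \notin A].
Proof.
move=> uo closD xD; apply/idP/idP.
  case/and3P=> /subsetDP[AD /pred0P AU] isoA uA; rewrite /stable_isotropic AD isoA uA /=.
  have := AU x; have := AU (o x); rewrite /= mem_sym_o // sym_orbit_id !andbT.
  by move=> -> ->.
case/and3P=> /and3P[AD isoA uA] xA oxA.
rewrite /stable_isotropic isoA uA !andbT; apply/subsetP=> z zA; rewrite inE (subsetP AD) // andbT.
have zsub := subsetP (porbit_sub_stable (eqP uA) zA).
apply/setUP=> -[]; rewrite porbit_sym => /zsub; first by rewrite (negPf xA).
by rewrite (negPf oxA).
Qed.

Local Open Scope ring_scope.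
Variable R : comNzRingType.

Definition isotropic_poly u D : {poly R} :=
  \sum_(A : {set T} | stable_isotropic u D A) 'X^#|A|.

(** A stable isotropic set containing [x] contains its orbit Q and misses the opposite orbit, so
    removing Q is a bijection onto the stable isotropic sets off the symmetric orbit. *)
Lemma isotropic_poly_in u x D : commute u o ->
    {in D, forall z, u z \in D /\ o z \in D} -> x \in D -> ~~ negative_orbit o u x ->
  \sum_(A : {set T} | stable_isotropic u D A && (x \in A)) 'X^#|A| =
  isotropic_poly u (D :\: sym_orbit o u x) * 'X^#|porbit u x|.
Proof.
move=> uo closD xD pos; set Q := porbit u x.
have QD : Q \subset D by apply: subset_trans (sym_orbit_sub closD xD); apply: subsetUl.
rewrite (reindex_onto (fun A => A :|: Q) (fun A => A :\: Q)) /=; last first.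
  move=> A /andP[/and3P[_ _ /eqP uA] xA].
  apply/setP=> z; rewrite !inE; case: (boolP (z \in Q)) => [zQ|_]; last by rewrite orbF.
  by rewrite (subsetP (porbit_sub_stable uA xA)).
rewrite big_distrl /=.
have QU : Q \subset sym_orbit o u x by apply: subsetUl.
have uQ := porbit_stable u x : u @: Q = Q.
have typeQ z : z \in Q -> o z \notin Q.
  move=> zQ; have [_ zpos] := sym_orbit_type oK uo (subsetP QU _ zQ).
  move: pos; rewrite -zpos /negative_orbit /Q -(eqP (_ : porbit u z == porbit u x)) //.
  by rewrite eq_porbit_mem.
apply: eq_big => [A|A]; last first.
  case/andP=> _ /eqP AQ; rewrite cardsU; have -> : A :&: Q = set0.
    by apply/setP=> z; rewrite -{1}AQ !inE; case: (z \in Q); rewrite ?andbF.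
  by rewrite cards0 subn0 exprD.
apply/idP/idP.
  case/andP=> /andP[/and3P[AQD /forall_inP isoAQ /eqP uAQ] _] /eqP AQ.
  have disjAQ z : z \in A -> z \notin Q by rewrite -AQ inE => /andP[].
  apply/and3P; split.
  - apply/subsetP=> z zA; have zAQ : z \in A :|: Q by rewrite inE zA.
    rewrite !inE (subsetP AQD) // andbT negb_or disjAQ //=.
    apply: contra (isoAQ _ zAQ); rewrite -(mem_porbit_o z _ uo) oK => ozQ.
    by rewrite inE ozQ orbT.
  - apply/forall_inP=> z zA; apply: contra (isoAQ z _); rewrite inE ?zA //.
    by move=> ->.
  apply/eqP/imset_perm_stable => z zA.
  have : u z \in A :|: Q by rewrite mem_imset_perm // inE zA.
  by rewrite inE -{2}(expg1 u) porbit_permX (negPf (disjAQ z zA)) orbF.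
case/and3P=> /subsetDP[AD /pred0P AU] /forall_inP isoA /eqP uA.
have disjAU z : z \in A -> z \notin sym_orbit o u x.
  by move=> zA; have := AU z; rewrite /= zA => /= ->.
have AQ : (A :|: Q) :\: Q = A.
  apply/setP=> z; rewrite !inE; case: (boolP (z \in Q)) => [zQ|_]; last by rewrite orbF.
  by apply/esym/negP => /disjAU; rewrite (subsetP QU).
rewrite AQ eqxx andbT inE porbit_id orbT andbT.
apply/and3P; split; first by rewrite subUset AD.
  2: by rewrite imsetU uA uQ.
apply/forall_inP=> z /setUP[zA|zQ]; rewrite inE negb_or.
  rewrite isoA //=; apply: contra (disjAU z zA) => /(subsetP QU).
  by rewrite mem_sym_o.
rewrite typeQ // andbT; apply/negP => /disjAU.
by rewrite mem_sym_o // (subsetP QU).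
Qed.

(** Symmetric orbits are removed one by one. A negative orbit meets no stable isotropic set and
    contributes 1; of two opposite m-cycles, such a set contains neither or exactly one, which
    contributes 1 + 2 X^m. The value of [a] at 0 is fixed separately, since the point count does not
    determine it. *)
Lemma isotropic_poly_prod u N D : commute u o -> (#|D| < N)%N ->
    {in D, forall z, u z \in D /\ o z \in D} ->
  exists a : nat -> nat, [/\ a 0%N = 0%N,
    forall m, #|[set z in D | orbit_type o u z == (m, false)]| = (2 * m * a m)%N &
    isotropic_poly u D = \prod_(m < #|T|.+1) (1 + 'X^m *+ 2) ^+ a m].
Proof.
move=> uo; elim: N D => // N IHN D ltDN closD.
have [->|[x xD]] := set_0Vmem D.
  exists (fun=> 0%N); split=> // [m|].
    by rewrite muln0; apply/eqP; rewrite cards_eq0; apply/eqP/setP=> z; rewrite !inE.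
  rewrite big1 /isotropic_poly => [|m _]; last by rewrite expr0.
  rewrite (big_pred1 set0) ?cards0 ?expr0 // => A /=.
  rewrite /stable_isotropic subset0; apply: andb_idr => /eqP->.
  by rewrite imset0 eqxx andbT; apply/forall_inP=> z; rewrite inE.
set m := #|porbit u x|.
have [||a [a0 card_a poly_a]] := IHN (D :\: sym_orbit o u x).
- rewrite -ltnS; apply: leq_trans ltDN; rewrite ltnS; apply: proper_card.
  rewrite properE subsetDl; apply/subsetPn; exists x => //.
  by rewrite inE sym_orbit_id.
- exact: closedD_sym_orbit.
have type_x t : ((t, false) == orbit_type o u x) = (t == m) && ~~ negative_orbit o u x.
  by rewrite xpair_eqE; case: negative_orbit.
have notin_x : \sum_(A : {set T} | stable_isotropic u D A && (x \notin A) && (o x \notin A)) 'X^#|A|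
    = isotropic_poly u (D :\: sym_orbit o u x) :> {poly R}.
  by apply: eq_bigl => A; rewrite (stable_isotropic_notin _ uo closD xD) andbA.
have [neg|pos] := boolP (negative_orbit o u x).
  exists a; split=> // [t|].
    by rewrite (card_type_sym_orbit oK _ uo closD xD) type_x neg andbF addn0 card_a.
  rewrite -poly_a -notin_x; apply: eq_bigl => A; rewrite -andbA; apply/esym/andb_idr.
  case/and3P=> AD isoA /eqP uA; have notA z : negative_orbit o u z -> z \notin A.
    move=> zneg; apply/negP=> zA; have /forall_inP/(_ z zA)/negP[] := isoA.
    exact: subsetP (porbit_sub_stable uA zA) _ zneg.
  rewrite !notA // /negative_orbit oK -eq_porbit_mem eq_sym eq_porbit_mem.
  exact: neg.
exists (fun t => a t + (t == m))%N; split=> [|t|].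
- rewrite a0 eq_sym eqn0Ngt; suff -> : (0 < m)%N by [].
  by apply/card_gt0P; exists x; apply: porbit_id.
  rewrite (card_type_sym_orbit oK _ uo closD xD) type_x pos andbT card_a card_sym_orbit //.
  rewrite (negPf pos) mulnDr; congr (_ + _)%N.
  by case: eqP => [->|]; rewrite ?muln1 ?muln0 // mulnC.
have ltm : (m < #|T|.+1)%N by rewrite ltnS max_card.
have -> : \prod_(t < #|T|.+1) (1 + 'X^t *+ 2) ^+ (a t + (t == m :> nat)) =
    (\prod_(t < #|T|.+1) (1 + 'X^t *+ 2) ^+ a t) * (1 + 'X^m *+ 2) :> {poly R}.
  under eq_bigr do rewrite exprD.
  rewrite big_split /=; congr (_ * _); rewrite (bigD1 (Ordinal ltm)) //= eqxx expr1.
  rewrite big1 ?mulr1 // => t; rewrite -val_eqE /= => /negPf->.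
  by rewrite expr0.
rewrite -poly_a /isotropic_poly (bigID (fun A : {set T} => x \in A)) /=.
rewrite isotropic_poly_in // [X in _ + X](bigID (fun A : {set T} => o x \in A)) /= notin_x.
(* Sets containing [o x] are counted like those containing [x], as both points have the same
   symmetric orbit. *)
have -> : \sum_(A : {set T} | stable_isotropic u D A && (x \notin A) && (o x \in A)) 'X^#|A|
    = isotropic_poly u (D :\: sym_orbit o u x) * 'X^m.
  have oxD : o x \in D by case: (closD x xD).
  have pos' : ~~ negative_orbit o u (o x) by rewrite /negative_orbit mem_porbit_o.
  have -> : sym_orbit o u x = sym_orbit o u (o x) by rewrite /sym_orbit oK setUC.
  rewrite /m -(card_porbit_o oK x uo) -isotropic_poly_in //; apply: eq_bigl => A.
  rewrite andbAC; apply: andb_idr => /andP[/and3P[_ /forall_inP isoA _] /isoA].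
  by rewrite oK.
by rewrite [RHS]mulrDr mulr1 mulrnAr mulr2n [LHS]addrA [LHS]addrC.
Qed.

End IsotropicPoly.

(** * Products of binomials 1 + 2 X^m in characteristic p *)

Section BinomialProducts.

Local Open Scope ring_scope.
Variable R : idomainType.
Implicit Types (f g : {poly R}) (c d : R) (m M : nat).

(** A truncated expansion modulo X^(M + 1), where [c = 0] is allowed; under multiplication the
    constants [c] add up. *)
Definition lead_after_one M f c :=
  exists q, f = 1 + c%:P * 'X^M + q * 'X^(M.+1).

(** As M > 0, the cross term in X^(2 M) falls into the remainder. *)
Lemma lead_after_oneM M f g c d : (0 < M)%N ->
  lead_after_one M f c -> lead_after_one M g d -> lead_after_one M (f * g) (c + d).
Proof.
case: M => // M _ [q ->] [r ->]; rewrite /lead_after_one !exprS polyCD.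
exists (q + r + c%:P * d%:P * 'X^M + (c%:P * r + d%:P * q) * 'X * 'X^M
        + q * r * 'X * 'X * 'X^M).
by ring.
Qed.

Lemma lead_after_one1 M : lead_after_one M 1 0.
Proof. by exists 0; rewrite polyC0 !mul0r !addr0. Qed.

Lemma lead_after_one_exp M f c k : (0 < M)%N ->
  lead_after_one M f c -> lead_after_one M (f ^+ k) (c *+ k).
Proof.
move=> M0 fc; elim: k => [|k IHk]; first exact: lead_after_one1.
by rewrite exprS mulrS; apply: lead_after_oneM.
Qed.

Lemma lead_after_one_prod M N (F : nat -> {poly R}) (C : nat -> R) : (0 < M)%N ->
  (forall m, (m < N)%N -> lead_after_one M (F m) (C m)) ->
  lead_after_one M (\prod_(m < N) F m) (\sum_(m < N) C m).
Proof.
move=> M0; elim: N => [|N IHN] FC; first by rewrite !big_ord0; apply: lead_after_one1.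
rewrite !big_ord_recr; apply: lead_after_oneM => //; last exact: FC.
by apply: IHN => m ltm; apply/FC/ltnW.
Qed.

Lemma lead_after_one_coef M f c : (0 < M)%N -> lead_after_one M f c -> f`_M = c.
Proof.
move=> M0 [q ->]; rewrite !coefD coef1 coefCM coefXn eqxx mulr1 coefMXn ltnSn addr0.
by rewrite gtn_eqF // add0r.
Qed.

Variable p : nat.
Hypotheses (charRp : p \in [pchar R]) (p_neq2 : p <> 2%N).

Let p_pr : prime p := pcharf_prime charRp.

(** Frobenius is additive, and writing 2 X^m as X^m + X^m preserves the coefficient 2. *)
Lemma binomial_frobenius m v :
  (1 + 'X^m *+ 2) ^+ (p ^ v) = 1 + 'X^(m * p ^ v) *+ 2 :> {poly R}.
Proof.
have pv : ([pchar {poly R}]).-nat (p ^ v)%N.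
  rewrite pnatX pnatE // (_ : _ \in _) ?orTb //.
  by rewrite pchar_poly.
by rewrite !mulr2n !exprDn_pchar // expr1n -exprM.
Qed.

(** For positive [m] and [k], the least positive degree occurring in (1 + 2 X^m)^k. *)
Definition frob_degree m k := (m * p ^ logn p k)%N.

(** Smaller [M] are included, with coefficient 0, so that all factors of a product can be expanded
    at the least of their degrees. *)
Lemma binomial_lead_after_one m k M : (0 < M)%N -> (M <= frob_degree m k)%N ->
  lead_after_one M ((1 + 'X^m *+ 2) ^+ k)
    ((if frob_degree m k == M then 2%:R else 0) *+ (k %/ p ^ logn p k)).
Proof.
move=> M0 leM; rewrite -{1}(divnK (pfactor_dvdnn p k)) mulnC exprM binomial_frobenius.
apply: lead_after_one_exp => //; rewrite -/(frob_degree m k) in leM *.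
case: eqP => [->|/eqP LM].
  by exists 0; rewrite mul0r addr0 mulr2n polyCD mulrDl !mul1r.
exists ('X^(frob_degree m k - M.+1) *+ 2).
by rewrite polyC0 mul0r addr0 mulrnAl -exprD subnK // ltn_neqAle eq_sym LM.
Qed.

(** The part of [frob_degree m k] prime to [p] is [m]. *)
Lemma frob_degree_inj m m' k k' : (0 < m)%N -> (0 < m')%N -> ~~ (p %| m)%N -> ~~ (p %| m')%N ->
  frob_degree m k = frob_degree m' k' -> m = m'.
Proof.
have part_frob t j : (0 < t)%N -> ~~ (p %| t)%N -> ((frob_degree t j)`_p^')%N = t.
  move=> t0 pt; have pj0 : (0 < p ^ logn p j)%N by rewrite expn_gt0 prime_gt0.
  rewrite partnM // part_pnat_id ?p'natE //.
  by rewrite part_p'nat ?muln1 // pnatNK pnatX pnat_id.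
by move=> m0 m0' pm pm' eq_f; rewrite -(part_frob m k) // eq_f part_frob.
Qed.

(* By the Frobenius map, [(1 + 2 X^m) ^ k] starts with [1 + 2 k' X^M], where
   [M = m * p ^ logn p k] and [k'] is the part of [k] prime to [p]. The
   exponents [M] are distinct for distinct [m], so the smallest one would occur
   in one of the two products only. *)
Lemma binomial_prod_disjoint N (a b : nat -> nat) :
    (forall m, a m = 0%N \/ b m = 0%N) ->
    (forall m, (a m + b m != 0)%N -> (0 < m)%N && ~~ (p %| m)%N) ->
    \prod_(m < N) (1 + 'X^m *+ 2) ^+ a m = \prod_(m < N) (1 + 'X^m *+ 2) ^+ b m :> {poly R} ->
  forall m, (m < N)%N -> a m = 0%N.
Proof.
(* Since [a t] or [b t] vanishes, [e t] is the other one. *)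
move=> ab0 supp eq_ab m ltm; pose e t := (a t + b t)%N.
apply/eqP/negPn/negP=> am0.
have em0 : e (Ordinal ltm) != 0%N by rewrite addn_eq0 negb_and am0.
case: (@arg_minnP _ (Ordinal ltm) (fun t : 'I_N => e t != 0%N)
   (fun t : 'I_N => frob_degree t (e t)) em0) => t0 et0 min_t0.
set M := frob_degree t0 (e t0) in min_t0.
have /andP[t0_gt0 pt0] := supp t0 et0.
have M0 : (0 < M)%N by rewrite muln_gt0 t0_gt0 expn_gt0 prime_gt0.
(* The coefficient of X^M in the factor at [t0], for an exponent [k] equal to 0 or [e t0]. *)
pose C k := (if k == 0%N then 0 else (2 * (k %/ p ^ logn p k))%:R) : R.
have lead (c : nat -> nat) : (forall t, c t = 0%N \/ c t = e t) ->
    lead_after_one M (\prod_(t < N) (1 + 'X^t *+ 2) ^+ c t) (C (c t0)).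
  move=> ce; have -> : C (c t0) = \sum_(t < N) (if t == t0 :> nat then C (c t) else 0).
    rewrite (bigD1 t0) //= eqxx big1 ?addr0 // => t.
    by rewrite -val_eqE => /negPf->.
  apply: (lead_after_one_prod (F := fun t => (1 + 'X^t *+ 2) ^+ c t)
    (C := fun t => if t == t0 :> nat then C (c t) else 0)) => // t lttN.
  have [ct0|ct0] := eqVneq (c t) 0%N.
    by rewrite ct0 expr0 /C eqxx if_same; apply: lead_after_one1.
  have cte : c t = e t by case: (ce t) ct0 => // ->.
  have et : e t != 0%N by rewrite -cte.
  have /andP[t_gt0 pt] := supp t et.
  have := @binomial_lead_after_one t (c t) M M0; rewrite cte => /(_ (min_t0 (Ordinal lttN) et)).
  rewrite /C (negPf et); have [->|neq_t] := eqVneq t t0.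
    by rewrite eqxx natrM mulr_natr.
  case: eqP => [/frob_degree_inj eq_t|]; last by rewrite mul0rn.
  by rewrite eq_t ?eqxx in neq_t.
have C0 : C (e t0) != 0.
  rewrite /C (negPf et0) -(dvdn_pcharf charRp) Euclid_dvdM // negb_or.
  rewrite dvdn_prime2 // (introF eqP p_neq2) /=.
  have e_gt0 : (0 < e t0)%N by rewrite lt0n.
  rewrite -[in X in _ %| X %/ _](partnC p e_gt0) p_part mulKn ?expn_gt0 ?prime_gt0 //.
  by rewrite -p'natE // part_pnat.
have ea : C (a t0) = C (b t0).
  rewrite -(lead_after_one_coef M0 (lead a _)) => [|t]; last first.
    by case: (ab0 t) => abt; [left | right; rewrite /e abt addn0].
  rewrite eq_ab (lead_after_one_coef M0 (lead b _)) // => t.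
  by case: (ab0 t) => abt; [right; rewrite /e abt | left].
(* One of the exponents at [t0] is 0 and the other is [e t0], so [ea] equates 0 with the nonzero
   [C (e t0)]. *)
have C00 : C 0%N = 0 by rewrite /C eqxx.
by case/eqP: C0; rewrite /e; case: (ab0 t0) ea => ->; rewrite ?addn0 C00.
Qed.

(** Cancelling the common factors, with exponents the minima of [a] and [b], leaves products with
    disjoint supports. *)
Lemma binomial_prod_inj N (a b : nat -> nat) :
    (forall m, (a m + b m != 0)%N -> (0 < m)%N && ~~ (p %| m)%N) ->
    \prod_(m < N) (1 + 'X^m *+ 2) ^+ a m = \prod_(m < N) (1 + 'X^m *+ 2) ^+ b m :> {poly R} ->
  forall m, (m < N)%N -> a m = b m.
Proof.
move=> supp eq_ab m ltm.
pose c t := minn (a t) (b t).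
have disj t : (a t - b t = 0 \/ b t - a t = 0)%N.
  by case: (leqP (a t) (b t)) => [|/ltnW]; rewrite -subn_eq0 => /eqP; [left | right].
have supp' t : ((a t - b t) + (b t - a t) != 0)%N -> (0 < t)%N && ~~ (p %| t)%N.
  move=> abt; apply: supp; apply: contraNneq abt => /eqP.
  by rewrite addn_eq0 => /andP[/eqP-> /eqP->].
have split_prod (u v : nat -> nat) : (forall t, u t = (c t + v t)%N) ->
    \prod_(t < N) (1 + 'X^t *+ 2) ^+ u t = (\prod_(t < N) (1 + 'X^t *+ 2) ^+ c t) *
      (\prod_(t < N) (1 + 'X^t *+ 2) ^+ v t) :> {poly R}.
  by move=> uv; rewrite -big_split /=; apply: eq_bigr => t _; rewrite uv exprD.
have two0 : 2%:R != 0 :> R.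
  by rewrite -(dvdn_pcharf charRp) dvdn_prime2 //; apply/eqP.
(* For t = 0 the binomial would be the constant 3, which is zero when p = 3. *)
have nz t : (0 < t)%N -> 1 + 'X^t *+ 2 != 0 :> {poly R}.
  move=> t0; apply/eqP=> /(congr1 (fun f : {poly R} => f`_t)).
  rewrite coefD coefMn coefXn coef1 coef0 eqxx gtn_eqF // add0r.
  by apply/eqP.
have cnz : \prod_(t < N) (1 + 'X^t *+ 2) ^+ c t != 0 :> {poly R}.
  apply/prodf_neq0 => t _; have [->|ct0] := eqVneq (c t) 0%N; first by rewrite oner_neq0.
  rewrite expf_neq0 // nz //; suff /supp/andP[] : (a t + b t != 0)%N by [].
  by apply: contraNneq ct0 => /eqP; rewrite addn_eq0 /c => /andP[/eqP-> _]; rewrite min0n.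
have eq_ab' : \prod_(t < N) (1 + 'X^t *+ 2) ^+ (a t - b t) =
    \prod_(t < N) (1 + 'X^t *+ 2) ^+ (b t - a t) :> {poly R}.
  apply: (mulfI cnz); rewrite -(split_prod a (fun t => a t - b t)%N) => [|t].
    rewrite -(split_prod b (fun t => b t - a t)%N) // => t.
    by rewrite /c minnC minnE subnK // leq_subr.
  by rewrite /c minnE subnK // leq_subr.
apply/eqP; rewrite eqn_leq -!subn_eq0.
rewrite (binomial_prod_disjoint disj supp' eq_ab' ltm) eqxx /=.
have disj' t : (b t - a t = 0 \/ a t - b t = 0)%N by case: (disj t); [right | left].
have supp'' t : ((b t - a t) + (a t - b t) != 0)%N -> (0 < t)%N && ~~ (p %| t)%N.
  by rewrite addnC; apply: supp'.
by rewrite (binomial_prod_disjoint disj' supp'' (esym eq_ab') ltm).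
Qed.

End BinomialProducts.

(** * Regular parts *)

Section RegularPart.

Variables (T : finType) (p : nat).
Implicit Types (w : {perm T}) (x : T).

Lemma card_porbit_dvdn_order w x : #|porbit w x| %| #[w].
Proof. by rewrite -permX_eqE expg_order perm1. Qed.

(** Such an exponent kills the [p]-part of [w]. *)
Lemma exp_regular_part w k : w ^+ (k * #[w.`_p]) = w.`_p^' ^+ (k * #[w.`_p]).
Proof.
rewrite -{1}(consttC p w) expgMn; last exact: (commuteX2 _ _ (commute_refl w)).
by rewrite mulnC expgM expg_order expg1n mul1g.
Qed.

Lemma porbit_constt_p' w x : prime p -> p^'.-nat #|porbit w.`_p^' x|.
Proof.
by move=> p_pr; apply: pnat_dvd (card_porbit_dvdn_order _ _) (p_elt_constt _ _).
Qed.

(* Both sizes are the part prime to [p] of the common size of the two orbits. *)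
Lemma card_porbit_constt_eq w w' x x' : prime p ->
  #|porbit w x| = #|porbit w' x'| -> #|porbit w.`_p^' x| = #|porbit w'.`_p^' x'|.
Proof.
move=> p_pr; suff dvd (v v' : {perm T}) (y y' : T) : #|porbit v y| = #|porbit v' y'| ->
    #|porbit v.`_p^' y| %| #|porbit v'.`_p^' y'|.
  by move=> eq_ww'; apply/eqP; rewrite eqn_dvd !dvd.
move=> eq_vv'; set q' := #|porbit v'.`_p^' y'|.
have dvq : #|porbit v.`_p^' y| %| #|porbit v y|.
  have /cycleP[a ->] := cycle_constt p^' v.
  by rewrite -permX_eqE -expgM permX_eqE dvdn_mull.
have dvq' : #|porbit v' y'| %| q' * #[v'.`_p].
  by rewrite -permX_eqE exp_regular_part permX_eqE dvdn_mulr.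
have := dvdn_trans dvq (etrans (congr1 (dvdn^~ _) eq_vv') dvq').
rewrite Gauss_dvdl // coprime_sym.
by apply: (@pnat_coprime p); [apply: p_elt_constt | apply: porbit_constt_p'].
Qed.

(** If w^k x = o x, then w^(k j) x = o^j x. For j the order of the [p]-part, which is odd, this is o
    x, and w^(k j) is a power of the p'-part. *)
Lemma negative_orbit_constt (o w : {perm T}) x : involutive o -> commute w o -> odd p ->
  prime p -> negative_orbit o w.`_p^' x = negative_orbit o w x.
Proof.
move=> oK wo odd_p p_pr; apply/idP/idP=> /porbitP[k ox].
  by have /cycleP[a wa] := cycle_constt p^' w; rewrite /negative_orbit ox wa -expgM mem_porbit.
have odd_order : odd #[w.`_p].
  by have /p_natP[e ->] : p.-nat #[w.`_p] := p_elt_constt p w; rewrite oddX odd_p orbT.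
have odd_fix j : (w ^+ (k * j)) x = if odd j then o x else x.
  elim: j => [|j IHj]; first by rewrite muln0 perm1.
  rewrite mulnS expgD permM -ox -commX // IHj /=.
  by case: (odd j) => //=; rewrite oK.
apply/porbitP; exists (k * #[w.`_p])%N; by rewrite -exp_regular_part odd_fix odd_order.
Qed.

End RegularPart.

(** * Negative cycles of Coxeter elements and conjugacy of regular parts *)

Section TypeB.

Variable n : nat.
Implicit Types (i j l : 'I_n) (J K L M : {set {perm signed_pt n}}) (w : {perm signed_pt n}).

Local Notation W := (Bgroup n).
Local Notation S := (Bgens n).
Local Notation o := (opp_perm n).

Lemma opp_permK : involutive o.
Proof. by case=> i e; rewrite !permE /opp_pt /= negbK. Qed.

Lemma opp_perm_free x : o x != x.
Proof. by case: x => i []; rewrite permE /opp_pt xpair_eqE andbF. Qed.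

(** If s_l with l <= i were missing from [K], [w] would stabilise [tail l e], which contains
    [(i, e)] but not its opposite. So [<<K>>] can move the point 1 to [(i, e)], and by
    [coxeter_stab] it stabilises the orbit. *)
Lemma coxeter_porbit_zero K w i e (z : 'I_n) : K \subset S -> coxeter_element K w -> z = 0 :> nat ->
  negative_orbit o w (i, e) -> (z, false) \in porbit w (i, e).
Proof.
move=> KS wK z0 neg; have wgen := coxeter_gen wK.
have iK l : l <= i -> Bgen l \in K.
  move=> li; apply/negPn/negP=> lK.
  have := subsetP (porbit_sub_stable (gen_tail e KS lK wgen) (_ : (i, e) \in _)) _ neg.
  by rewrite permE !inE li eqxx => /(_ isT); case: e {neg}.
have stab_K : <<K>> \subset stab_group (porbit w (i, e)).
  rewrite gen_subG; apply/subsetP=> y yK; rewrite inE.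
  by rewrite (coxeter_stab KS wK (porbit_stable w (i, e)) yK).
have zi : z <= i by rewrite z0.
have [g gK gz] : exists2 g, g \in <<K>> & g (z, false) = (i, e).
  case: e {neg stab_K}.
    by have [g gK [gz _]] := climb_neg zi iK; exists g.
  have [l /andP[_]|g gK [gz _]] := @climb n K z i zi; first exact: iK.
  by exists g.
have /(subsetP stab_K) := gK; rewrite inE => /eqP/(mem_imset_perm (z, false)) <-.
by rewrite gz porbit_id.
Qed.

(** All negative orbits contain the point 1, so there is at most one, and counting negative points
    gives its length. *)
Lemma coxeter_neg_orbit K w x : K \subset S -> coxeter_element K w ->
  negative_orbit o w x -> porbit w x = [set y | negative_orbit o w y].
Proof.
move=> KS wK neg; have wo : commute w o by have /cent1P := coxeter_Bgroup KS wK.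
have n0 : 0 < n by case: x {neg} => i _; apply: leq_ltn_trans (ltn_ord i).
have zx y : negative_orbit o w y -> (Ordinal n0, false) \in porbit w y.
  by case: y => i e; apply: (coxeter_porbit_zero KS wK).
apply/setP=> y; rewrite inE; apply/idP/idP=> [yx|/zx zy].
  have yU : y \in sym_orbit o w x by rewrite inE yx.
  by have := sym_orbit_type opp_permK wo yU; rewrite /orbit_type => -[_ ->].
move: (zx x neg); rewrite -!eq_porbit_mem in zy * => /eqP <-.
by rewrite eq_sym.
Qed.

Lemma card_type_pos (T : finType) (o' : {perm T}) (u : {perm T}) :
  #|[set z | ~~ negative_orbit o' u z]| =
    \sum_(m < #|T|.+1) #|[set z | orbit_type o' u z == (m : nat, false)]|.
Proof.
have ltT z : #|porbit u z| < #|T|.+1 by rewrite ltnS max_card.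
rewrite -sum1_card (partition_big (fun z => Ordinal (ltT z)) xpredT) //=.
apply: eq_bigr => m _; rewrite -[RHS]sum1_card; apply: eq_bigl => z.
rewrite !inE -val_eqE /= xpair_eqE andbC; case: negative_orbit; by rewrite ?andbF ?andbT.
Qed.

(** The sizes n - l run through 1, ..., n. Only the empty set has size 0, and an isotropic set,
    being disjoint from its opposite, has at most n elements. *)
Lemma isotropic_poly_eq (R : comNzRingType) p (u v : {perm signed_pt n}) : p \in [pchar R]%R ->
  (forall l, #|[set A | [&& isotropic o A, #|A| == (n - l)%N & u @: A == A]]| =
             #|[set A | [&& isotropic o A, #|A| == (n - l)%N & v @: A == A]]| %[mod p]) ->
  isotropic_poly o R u setT = isotropic_poly o R v setT.
Proof.
move=> charRp eq_uv; apply/polyP=> k.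
have coefE w : ((isotropic_poly o R w setT)`_k =
   #|[set A | [&& isotropic o A, #|A| == k & w @: A == A]]|%:R)%R.
  rewrite coef_sum -sum1_card natr_sum big_mkcond [RHS]big_mkcond /=; apply: eq_bigr => A _.
  rewrite inE /stable_isotropic subsetT coefXn (eq_sym k) /=.
  by case: (isotropic o A) => //=; case: (#|A| == k) => //=; rewrite if_same.
rewrite !coefE.
have [->|k0] := posnP k.
  have card0 w : #|[set A | [&& isotropic o A, #|A| == 0%N & w @: A == A]]| = 1%N.
    rewrite -(cards1 (set0 : {set signed_pt n})); apply: eq_card => A; rewrite !inE cards_eq0.
    have [->|//] := eqVneq A set0; last by rewrite andbF.
    by apply/and3P; split; rewrite ?imset0 //; apply/forall_inP => z; rewrite inE.
  by rewrite !card0.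
have [lekn|ltnk] := leqP k n.
  have ltl : n - k < n by rewrite ltn_subrL k0 (leq_trans k0).
  have := eq_uv (Ordinal ltl); rewrite /= subKn // => eq_k.
  by rewrite -(GRing.natr_mod_pchar charRp) eq_k GRing.natr_mod_pchar.
have card_big w : #|[set A | [&& isotropic o A, #|A| == k & w @: A == A]]| = 0%N.
  apply/eqP; rewrite cards_eq0 -subset0; apply/subsetP=> A; rewrite inE.
  case/and3P=> /forall_inP isoA /eqP cardA _; move: ltnk; rewrite ltnNge => /negP[].
  rewrite -(leq_pmul2r (isT : 0 < 2)) muln2 -addnn.
  have -> : (n * 2 = #|A| + #|~: A|)%N by rewrite cardsC card_prod card_ord card_bool.
  rewrite cardA leq_add2l -cardA -(card_imset A (@perm_inj _ o)); apply: subset_leq_card.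
  by apply/subsetP=> _ /imsetP[z zA ->]; rewrite inE isoA.
by rewrite !card_big.
Qed.

Lemma regular_part_conj p K L w (v : {perm signed_pt n}) :
    prime p -> p <> 2 -> K \subset S -> L \subset S ->
    coxeter_element K w -> coxeter_element L v ->
    (forall l, #|[set A | [&& isotropic o A, #|A| == (n - l)%N & w.`_p^' @: A == A]]| =
               #|[set A | [&& isotropic o A, #|A| == (n - l)%N & v.`_p^' @: A == A]]| %[mod p]) ->
  v.`_p^' \in w.`_p^' ^: W.
Proof.
move=> p_pr p2 KS LS wK vL eq_wv.
have wo : commute w o by have /cent1P := coxeter_Bgroup KS wK.
have vo : commute v o by have /cent1P := coxeter_Bgroup LS vL.
have odd_p : odd p by case: (even_prime p_pr).
have oK : involutive o by exact: opp_permK.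
have charFp : p \in [pchar 'F_p]%R by apply: pchar_Fp.
have regC g : commute g o -> commute g.`_p^' o.
  by move=> go; have /cycleP[a ->] := cycle_constt p^' g; apply/commute_sym/commuteX/commute_sym.
have wo' := regC _ wo; have vo' := regC _ vo.
set T := signed_pt n; pose u1 := w.`_p^'; pose u2 := v.`_p^'.
have closedT g : {in [set: T], forall z, g z \in [set: T] /\ o z \in [set: T]}.
  by move=> z _; rewrite !inE.
have ltT : #|[set: T]| < #|T|.+1 by rewrite cardsT.
have [a [a0 card_a poly_a]] := isotropic_poly_prod oK 'F_p wo' ltT (closedT _).
have [b [b0 card_b poly_b]] := isotropic_poly_prod oK 'F_p vo' ltT (closedT _).
(* A nonzero exponent at [m] means that the regular part has an orbit of length [m], and such
   lengths are prime to [p]. *)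
have supp g (c : nat -> nat) m : c 0%N = 0%N ->
    (forall m, #|[set z in [set: T] | orbit_type o g.`_p^' z == (m, false)]| = (2 * m * c m)%N) ->
    c m != 0%N -> 0 < m /\ ~~ (p %| m).
  move=> c0 card_c cm0; have m0 : 0 < m by rewrite lt0n; apply: contraNneq cm0 => ->; rewrite c0.
  split=> //; have : 0 < #|[set z in [set: T] | orbit_type o g.`_p^' z == (m, false)]|.
    by rewrite card_c !muln_gt0 m0 /= lt0n.
  case/card_gt0P=> z; rewrite !inE /= xpair_eqE => /andP[/eqP <- _].
  by rewrite -p'natE //; apply: porbit_constt_p'.
have eq_pos m : #|[set z | orbit_type o u1 z == (m, false)]| =
    #|[set z | orbit_type o u2 z == (m, false)]|.
  have inT g : [set z | orbit_type o g z == (m, false)] =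
      [set z in [set: T] | orbit_type o g z == (m, false)].
    by apply/setP=> z; rewrite !inE.
  have [ltm|lem] := ltnP m #|T|.+1.
    rewrite !inT card_a card_b (binomial_prod_inj charFp p2 (N := #|T|.+1) (a := a) (b := b)) //.
      move=> t; rewrite addn_eq0 negb_and => /orP[]; first by case/(supp w a t a0 card_a)=> -> ->.
      by case/(supp v b t b0 card_b)=> -> ->.
    by rewrite -poly_a -poly_b; apply: (isotropic_poly_eq charFp).
  have big0 g : #|[set z | orbit_type o g z == (m, false)]| = 0%N.
    apply/eqP; rewrite cards_eq0 -subset0; apply/subsetP=> z.
    rewrite inE xpair_eqE => /andP[/eqP zm _].
    by move: lem; rewrite -zm ltnNge max_card.
  by rewrite !big0.
have neg_part g : commute g o ->
    [set z | negative_orbit o g.`_p^' z] = [set z | negative_orbit o g z].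
  by move=> go; apply/setP=> z; rewrite !inE negative_orbit_constt.
(* Passing to the regular part keeps the negative points, and these are the complement of the points
   of positive type, already counted. *)
have eq_neg : #|[set z | negative_orbit o w z]| = #|[set z | negative_orbit o v z]|.
  have card_neg g : #|[set z | negative_orbit o g z]| =
      (#|T| - \sum_(m < #|T|.+1) #|[set z | orbit_type o g z == (m : nat, false)]|)%N.
    rewrite cardsCs -card_type_pos; congr (_ - _)%N.
    by apply: eq_card => z; rewrite !inE.
  rewrite -(neg_part w wo) -(neg_part v vo) !card_neg; congr (_ - _)%N.
  by apply: eq_bigr => m _; apply: eq_pos.
have eq_size g h J M x y : J \subset S -> M \subset S ->
    coxeter_element J g -> coxeter_element M h ->
    #|[set z | negative_orbit o g z]| = #|[set z | negative_orbit o h z]| ->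
    negative_orbit o g x -> negative_orbit o h y -> #|porbit g.`_p^' x| = #|porbit h.`_p^' y|.
  move=> JS MS gJ hM eq_gh gx hy; apply: card_porbit_constt_eq => //.
  by rewrite (coxeter_neg_orbit JS gJ gx) (coxeter_neg_orbit MS hM hy).
apply: (conj_of_orbit_types oK (@opp_perm_free)) => // -[m []]; last exact: eq_pos.
have type_neg g : commute g o -> [set z | orbit_type o g.`_p^' z == (m, true)] =
    [set z in [set z | negative_orbit o g z] | #|porbit g.`_p^' z| == m].
  by move=> go; apply/setP=> z; rewrite !inE xpair_eqE eqb_id negative_orbit_constt // andbC.
rewrite !type_neg //.
have [w0|[x]] := set_0Vmem [set z | negative_orbit o w z].
  have /eqP := eq_neg; rewrite w0 cards0 eq_sym cards_eq0 => /eqP->.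
  by apply: eq_card => z; rewrite !inE.
rewrite inE => wx.
have : 0 < #|[set z | negative_orbit o v z]|.
  by rewrite -eq_neg; apply/card_gt0P; exists x; rewrite inE.
case/card_gt0P=> y; rewrite inE => vy.
(* The negative points all have regular-part orbits of one length, so those with length [m] are all
   of them or none. *)
have same g J y' : J \subset S -> coxeter_element J g ->
    #|[set z | negative_orbit o w z]| = #|[set z | negative_orbit o g z]| ->
    negative_orbit o g y' ->
    [set z in [set z | negative_orbit o g z] | #|porbit g.`_p^' z| == m] =
    if #|porbit w.`_p^' x| == m then [set z | negative_orbit o g z] else set0.
  move=> JS gJ eq_wg gy'; apply/setP=> z; rewrite !inE; case gz: (negative_orbit o g z) => /=.
    by rewrite -(eq_size w g K J x z) //; case: eqP; rewrite !inE ?gz.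
  by case: ifP; rewrite !inE ?gz.
by rewrite (same w K x) // (same v L y) //; case: ifP.
Qed.

End TypeB.

Theorem theorem7 (n p : nat) (E : {set {set {perm signed_pt n}}})
    (c : {set {perm signed_pt n}} -> {perm signed_pt n})
    (n_gt0 : (0 < n)%N) (p_prime : prime p)
    (E_reps : subset_class_reps (Bgroup n) (Bgens n) E)
    (c_coxeter : forall J : {set {perm signed_pt n}},
       J \subset Bgens n -> coxeter_element J (c J)) :
  (p <> 2 ->
     forall K L : {set {perm signed_pt n}},
       K \in E -> L \in nonzero_rows (Bgroup n) p E ->
       (decomp (Bgroup n) p E K L = 1%N <->
        (c L).`_p^' \in (c K).`_p^' ^: Bgroup n)) /\
  (p = 2 ->
     nonzero_rows (Bgroup n) p E = [set Bgens n] /\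
     (forall K : {set {perm signed_pt n}},
        K \in E -> decomp (Bgroup n) p E K (Bgens n) = 1%N)).
Proof.
have cE J : J \in E -> coxeter_element J (c J).
  by move=> /(reps_sub E_reps); apply: c_coxeter.
split=> [p2 K L KE|->]; last by split=> [|K KE]; [apply: nonzero_rows2 | apply: decomp2].
rewrite inE => /andP[LE _].
have [KS LS] := (reps_sub E_reps KE, reps_sub E_reps LE).
have wB J : J \in E -> (c J).`_p^' \in Bgroup n.
  move=> JE; apply: (subsetP _ _ (cycle_constt p^' (c J))); rewrite cycle_subG.
  exact: coxeter_Bgroup (reps_sub E_reps JE) (cE J JE).
rewrite /decomp; split=> [|/imsetP[h hB conj_KL]].
  case: forall_inP => // eq_cols _.
  apply: (regular_part_conj p_prime p2 KS LS (cE K KE) (cE L LE)) => l.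
  (* Only the rows of representatives of the maximal subsets of S are used here. *)
  have [|J JE Jl] := reps_exists E_reps (_ : Bgens n :\ Bgen l \subset Bgens n).
    exact: subsetDl.
  have JS := reps_sub E_reps JE.
  rewrite -!(card_fix_maximal_parabolic _ Jl) ?wB //; have /eqP := eq_cols J JE.
  by rewrite (mark_constt p_prime JS KS (cE K KE)) (mark_constt p_prime JS LS (cE L LE)).
(* Conversely, conjugate regular parts fix equally many cosets, so the columns agree in every
   row. *)
case: forall_inP => // -[] J JE; have JS := reps_sub E_reps JE.
rewrite (mark_constt p_prime JS KS (cE K KE)) (mark_constt p_prime JS LS (cE L LE)).
by rewrite conj_KL card_rcosets_fixJ.
Qed.
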